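(* Let $\mathbf{K}$ be an algebraically trivial Fraïssé class with $|S_1(T_{\mathbf{K}})|=1$. If $T_{\mathbf{K}}$ is unstable and $\mathbf{K}$ is simply Ramsey-expandable, then for every $T\in\mathbb{T}$ the following are equivalent: (1) $T\in\mathcal{C}_{\mathbf{K}}$. (2) There is an un-collapsed indiscernible picture of $\mathcal{A}^<$ in a model of $T$, where $\mathcal{A}^<$ is the generic model of $\mathbf{K}^<$.
   Context: Theories and the ordering $\trianglelefteq$. $\mathbb{T}$ is the class of all complete first-order (possibly many-sorted) theories with infinite models that eliminate imaginaries; $\mathcal{L}_T$ is the language of $T$. A theory $T$ that may not eliminate imaginaries is freely identified with $T^{\mathrm{eq}}$. Fix a countably infinite set $A$. For $T\in\mathbb{T}$, $\mathbf{F}(T)$ is the set of injections $f:B\to M$, where $B\subset A$ is finite and $M$ is the universe of some model $\mathcal{M}\models T$, such that all $f(a)$, $a\in B$, lie in one sort, and for every $B_0\subsetneq B$ the type $\mathrm{tp}(f[B]/f[B_0])$ is non-algebraic. A sequence $\boldsymbol\phi=(\phi_0,\dots,\phi_{N-1})$ of $\mathcal{L}_T$-formulas is always finite and all free variables range over one common sort (the sort of $\boldsymbol\phi$); if $\phi_i=\phi_i(x_0,\dots,x_{n_i-1})$, then $\mathcal{L}_{\boldsymbol\phi}$ is the one-sorted language with signature $\{R_0^{(n_0)},\dots,R_{N-1}^{(n_{N-1})}\}$ (the languages of two sequences that coordinate-wise have the same arities are identified). $\mathbf{F}_{\boldsymbol\phi}(T)$ is the set of $f\in\mathbf{F}(T)$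 with values in the sort of $\boldsymbol\phi$; for such $f:B\to M$, $B_{\boldsymbol\phi}(f)$ is the $\mathcal{L}_{\boldsymbol\phi}$-structure with universe $B$ and $R_i=\{\overline a\in B^{n_i}:\mathcal{M}\models\phi_i(f\overline a)\}$. $\mathrm{Age}_{\boldsymbol\phi}(T)=\{B_{\boldsymbol\phi}(f):f\in\mathbf{F}_{\boldsymbol\phi}(T)\}$ up to isomorphism. For $T_1,T_2\in\mathbb{T}$, $T_1\trianglelefteq T_2$ means: for every finite sequence $\boldsymbol\phi^1$ of $\mathcal{L}_{T_1}$-formulas there is a sequence $\boldsymbol\phi^2$ of $\mathcal{L}_{T_2}$-formulas, coordinate-wise of the same arities, with $\mathrm{Age}_{\boldsymbol\phi^1}(T_1)\subseteq\mathrm{Age}_{\boldsymbol\phi^2}(T_2)$. Fraïssé classes. A Fraïssé class is a class of finite structures in a one-sorted finite relational language having the hereditary, joint-embedding and amalgamation properties. $T_{\mathbf{K}}$ is the complete theory of the generic model (Fraïssé limit) of $\mathbf{K}$. $\mathbf{K}$ is algebraically trivial if $\mathrm{acl}^{\mathcal{M}}(X)=X$ for all $\mathcal{M}\models T_{\mathbf{K}}$ and $X\subseteq M$ (equivalently, $\mathbf{K}$ has disjoint-JEP and disjoint-AP). For such $\mathbf{K}$, $\mathcal{C}_{\mathbf{K}}=\{T\in\mathbb{T}:T_{\mathbf{K}}\trianglelefteq T\}$. Generic order-expansion. For an algebraically trivial Fraïssé class $\mathbf{K}$ in $\mathcal{L}_{\mathbf{K}}$ with $|S_1(T_{\mathbf{K}})|=1$,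 $\mathcal{L}_{\mathbf{K}}^<$ is $\mathcal{L}_{\mathbf{K}}$ with one new binary relation symbol $<$, and $\mathbf{K}^<$ is the class of all finite $\mathcal{L}_{\mathbf{K}}^<$-structures $B$ whose reduct to $\mathcal{L}_{\mathbf{K}}$ is in $\mathbf{K}$ and for which $<^B$ is a linear ordering of $B$; it is again an algebraically trivial Fraïssé class. $\mathbf{K}$ is simply Ramsey-expandable if $\mathbf{K}^<$ has the Ramsey property. Ramsey property. A Fraïssé class $\mathbf{K}$ has the Ramsey property if for all $D,B\in\mathbf{K}$ and $0<k<\omega$ there is $C\in\mathbf{K}$ such that for every coloring $\xi:\mathrm{Emb}(D,C)\to k$ of the embeddings of $D$ in $C$ there is an embedding $u:B\to C$ such that $\xi$ is constant on $\mathrm{Emb}(D,uB)$. Pictures. For a generic model $\mathcal{A}$ of a Fraïssé class and an infinite structure $\mathcal{M}$, a picture $\gamma:\mathcal{A}\to\mathcal{M}$ is an injective map of the universe of $\mathcal{A}$ into a single sort of $\mathcal{M}$. It is indiscernible if for all $n$ and $n$-tuples $\overline a,\overline b$ from $\mathcal{A}$, $\mathrm{qftp}^{\mathcal{A}}(\overline a)=\mathrm{qftp}^{\mathcal{A}}(\overline b)$ implies $\mathrm{tp}^{\mathcal{M}}(\gamma\overline a)=\mathrm{tp}^{\mathcal{M}}(\gamma\overline b)$ (qftp = quantifier-free type). An indiscernible picture is un-collapsed if, conversely, $\mathrm{tp}^{\mathcal{M}}(\gamma\overline a)=\mathrm{tp}^{\mathcal{M}}(\gamma\overline b)$ implies $\mathrm{qftp}^{\mathcal{A}}(\overline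 a)=\mathrm{qftp}^{\mathcal{A}}(\overline b)$ for all such $\overline a,\overline b$. *)

(* Defs.v *)
From mathcomp Require Import all_boot finmap.
From mathcomp Require Import boolp classical_sets functions cardinality.

Set Implicit Arguments.
Unset Strict Implicit.
Unset Printing Implicit Defensive.

Local Open Scope classical_set_scope.

Record language := Language {
  lsort : Type;
  fsym : Type;
  farity : fsym -> nat;
  fdom : forall f, 'I_(farity f) -> lsort;
  fcod : fsym -> lsort;
  rsym : Type;
  rarity : rsym -> nat;
  rdom : forall r, 'I_(rarity r) -> lsort }.

(* Formulas are well-sorted by construction. A context is a map
   [G : V -> lsort L] giving the sort of each free variable, the variables
   being the elements of the type [V]; a quantifier binds the variable [None]
   of [option V]. *)
Definition ctx_cons (S V : Type) (s : S) (G : V -> S) : option V -> S :=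
  fun o => if o is Some v then G v else s.

Definition ctx_cat (S V W : Type) (G : V -> S) (H : W -> S) : V + W -> S :=
  fun o => match o with inl v => G v | inr w => H w end.

Definition ctx_nil (S : Type) : void -> S := fun v => match v with end.

Inductive term (L : language) (V : Type) (G : V -> lsort L) : lsort L -> Type :=
| tvar (v : V) : term G (G v)
| tapp (f : fsym L) (args : forall i, term G (@fdom L f i)) :
    term G (fcod f).

Inductive formula (L : language) (V : Type) (G : V -> lsort L) : Type :=
| f_eq (s : lsort L) (t u : term G s)
| f_rel (r : rsym L) (args : forall i, term G (@rdom L r i))
| f_bot
| f_imp (p q : formula G)
| f_all (s : lsort L) (p : formula (ctx_cons s G)).

Arguments f_bot {L V G}.

Fixpoint quantifier_free (L : language) (V : Type) (G : V -> lsort L)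
    (p : formula G) : Prop :=
  match p with
  | f_imp p q => quantifier_free p /\ quantifier_free q
  | f_all _ _ => False
  | _ => True
  end.

(* Empty carriers are allowed here, because the empty structure is a finite
   structure; models of a theory have nonempty sorts, see [models]. *)
Record structure (L : language) := Structure {
  carrier :> lsort L -> Type;
  finterp : forall f : fsym L,
    (forall i, carrier (@fdom L f i)) -> carrier (fcod f);
  rinterp : forall r : rsym L, (forall i, carrier (@rdom L r i)) -> Prop }.

Definition env (L : language) (M : structure L) (V : Type) (G : V -> lsort L) :=
  forall v, M (G v).

Definition env_nil (L : language) (M : structure L) :
  env M (@ctx_nil (lsort L)) := fun v => match v with end.

Definition env_cons (L : language) (M : structure L) (V : Type)
    (G : V -> lsort L) (s : lsort L) (c : M s) (a : env M G) :
    env M (ctx_cons s G) :=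
  fun o => match o with Some v => a v | None => c end.

Definition env_cat (L : language) (M : structure L) (V W : Type)
    (G : V -> lsort L) (H : W -> lsort L) (a : env M G) (b : env M H) :
    env M (ctx_cat G H) :=
  fun o => match o with inl v => a v | inr w => b w end.

Fixpoint eval (L : language) (M : structure L) (V : Type) (G : V -> lsort L)
    (a : env M G) (s : lsort L) (t : term G s) : M s :=
  match t in term _ s return M s with
  | tvar v => a v
  | tapp f args => finterp (fun i => eval a (args i))
  end.

Fixpoint sat (L : language) (M : structure L) (V : Type) (G : V -> lsort L)
    (p : formula G) : env M G -> Prop :=
  match p with
  | f_eq s t u => fun a => eval a t = eval a u
  | f_rel r args => fun a => rinterp (fun i => eval a (args i))
  | f_bot => fun _ => False
  | f_imp p q => fun a => sat p a -> sat q a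
  | f_all s p => fun a => forall c : M s, sat p (env_cons c a)
  end.

Definition sentence (L : language) := formula (@ctx_nil (lsort L)).

Definition holds (L : language) (M : structure L) (p : sentence L) : Prop :=
  sat p (env_nil M).

Definition theory (L : language) := set (sentence L).

Definition models (L : language) (M : structure L) (T : theory L) : Prop :=
  (forall s, inhabited (M s)) /\ (forall p, T p -> holds M p).

Definition Th (L : language) (M : structure L) : theory L :=
  [set p | holds M p].

Definition f_not (L : language) (V : Type) (G : V -> lsort L) (p : formula G) :=
  f_imp p f_bot.

Definition consequence (L : language) (T : theory L) (p : sentence L) : Prop :=
  forall M : structure L, models M T -> holds M p.

Definition complete_theory (L : language) (T : theory L) : Prop :=
  (exists M : structure L, models M T) /\
  (forall p, consequence T p \/ consequence T (f_not p)).

Definition tp (L : language) (M : structure L) (V : Type) (G : V -> lsort L)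
    (a : env M G) : set (formula G) := [set p | sat p a].

Definition qftp (L : language) (M : structure L) (V : Type) (G : V -> lsort L)
    (a : env M G) : set (formula G) := [set p | quantifier_free p /\ sat p a].

Definition type_space (L : language) (T : theory L) (n : nat)
    (G : 'I_n -> lsort L) : set (set (formula G)) :=
  [set p | exists M : structure L, models M T /\ exists a : env M G, p = tp a].

Arguments type_space {L} T {n} G.

(* tp(a / c) contains a formula with finitely many solutions; the parameters
   c are the values of the variables of the second half of the context. *)
Definition algebraic_tp (L : language) (M : structure L) (V W : Type)
    (G : V -> lsort L) (H : W -> lsort L) (a : env M G) (c : env M H) : Prop :=
  exists p : formula (ctx_cat G H),
    sat p (env_cat a c) /\
    finite_set [set a' : env M G | sat p (env_cat a' c)].

Definition order_property (L : language) (T : theory L) (m n : nat)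
    (G : 'I_m -> lsort L) (H : 'I_n -> lsort L) (p : formula (ctx_cat G H)) :
    Prop :=
  exists M : structure L, models M T /\
  exists (a : nat -> env M G) (b : nat -> env M H),
    forall i j : nat, sat p (env_cat (a i) (b j)) <-> (i < j)%N.

Definition unstable (L : language) (T : theory L) : Prop :=
  exists (m n : nat) (G : 'I_m -> lsort L) (H : 'I_n -> lsort L)
    (p : formula (ctx_cat G H)), order_property T p.

Definition is_equivalence (X : Type) (E : X -> X -> Prop) : Prop :=
  [/\ forall x, E x x, forall x y, E x y -> E y x &
      forall x y z, E x y -> E y z -> E x z].

Definition definable_equivalence (L : language) (T : theory L) (n : nat)
    (G : 'I_n -> lsort L) (E : formula (ctx_cat G G)) : Prop :=
  forall M : structure L, models M T ->
    is_equivalence (fun a b : env M G => sat E (env_cat a b)).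

(* The quotient map h of E takes values in a single sort, as it does in T^eq,
   rather than in a finite product of sorts: T^eq is the model for the theories
   considered here, and the maps of F(T) below take values in one sort. *)
Definition eliminates_imaginaries (L : language) (T : theory L) : Prop :=
  forall (n : nat) (G : 'I_n -> lsort L) (E : formula (ctx_cat G G)),
    definable_equivalence T E ->
    exists (s : lsort L) (p : formula (ctx_cons s G)),
      forall M : structure L, models M T ->
        exists h : env M G -> M s,
          (forall a c, sat p (env_cons c a) <-> h a = c) /\
          (forall a b, sat E (env_cat a b) <-> h a = h b).

Record imaginary_sort (L : language) (T : theory L) := ImaginarySort {
  im_n : nat;
  im_ctx : 'I_im_n -> lsort L;
  im_rel : formula (ctx_cat im_ctx im_ctx);
  im_equiv : definable_equivalence T im_rel }.

(* L^eq: one new sort for each definable equivalence relation E, together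
   with the projection onto it, the function symbol [inr E]. *)
Definition eq_language (L : language) (T : theory L) : language :=
  {| lsort := lsort L + imaginary_sort T;
     fsym := fsym L + imaginary_sort T;
     farity := fun f => match f with inl f => farity f | inr E => im_n E end;
     fdom := fun f =>
       match f return 'I_(match f with inl f => farity f | inr E => im_n E end)
                      -> lsort L + imaginary_sort T with
       | inl f => fun i => inl (fdom i)
       | inr E => fun i => inl (im_ctx i)
       end;
     fcod := fun f => match f with inl f => inl (fcod f) | inr E => inr E end;
     rsym := rsym L;
     rarity := @rarity L;
     rdom := fun r i => inl (rdom i) |}.

Definition im_class (L : language) (T : theory L) (M : structure L)
    (E : imaginary_sort T) (a : env M (@im_ctx _ _ E)) :
    set (env M (@im_ctx _ _ E)) :=
  [set b | sat (im_rel E) (env_cat a b)].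

Definition eq_carrier (L : language) (T : theory L) (M : structure L)
    (s : lsort (eq_language T)) : Type :=
  match s with
  | inl s => M s
  | inr E => {X : set (env M (@im_ctx _ _ E)) | exists a, X = im_class a}
  end.

Definition eq_structure (L : language) (T : theory L) (M : structure L) :
    structure (eq_language T) :=
  {| carrier := eq_carrier M;
     finterp := fun f : fsym (eq_language T) =>
       match f return (forall i, eq_carrier M (@fdom (eq_language T) f i)) ->
                      eq_carrier M (@fcod (eq_language T) f) with
       | inl f => fun a => @finterp L M f a
       | inr E => fun a => exist _ (@im_class L T M E a)
                             (ex_intro _ a erefl)
       end;
     rinterp := fun (r : rsym (eq_language T)) a => @rinterp L M r a |}.

Definition eq_theory (L : language) (T : theory L) : theory (eq_language T) :=
  [set p | forall M : structure L, models M T -> holds (eq_structure T M) p].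

Arguments eq_theory {L} T.

Definition infinite_structure (L : language) (M : structure L) : Prop :=
  infinite_set [set: {s & M s}].

Definition in_TT (L : language) (T : theory L) : Prop :=
  [/\ complete_theory T,
      exists M : structure L, models M T /\ infinite_structure M &
      eliminates_imaginaries T].

Record signature := Signature { symb : finType; arity : symb -> nat }.

Definition rlang (S : signature) : language :=
  {| lsort := unit;
     fsym := void;
     farity := fun f => match f with end;
     fdom := fun f => match f with end;
     fcod := fun f => match f with end;
     rsym := symb S;
     rarity := @arity S;
     rdom := fun _ _ => tt |}.

Definition rstructure (S : signature) := structure (rlang S).

Definition univ (S : signature) (A : rstructure S) : Type := A tt.

Definition mk_rstructure (S : signature) (X : Type)
    (R : forall r : symb S, ('I_(arity r) -> X) -> Prop) : rstructure S :=
  {| carrier := fun _ : lsort (rlang S) => X;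
     finterp := fun f : fsym (rlang S) => match f with end;
     rinterp := R |}.

Definition rrel (S : signature) (A : rstructure S) (r : symb S) :
    ('I_(arity r) -> univ A) -> Prop := @rinterp _ A r.

Definition is_embedding (S : signature) (A B : rstructure S)
    (e : univ A -> univ B) : Prop :=
  injective e /\
  forall (r : symb S) (a : 'I_(arity r) -> univ A), rrel a <-> rrel (e \o a).

Definition embedding (S : signature) (A B : rstructure S) :=
  {e : univ A -> univ B | is_embedding e}.

Definition is_isomorphism (S : signature) (A B : rstructure S)
    (e : univ A -> univ B) : Prop := is_embedding e /\ bijective e.

Definition isomorphic (S : signature) (A B : rstructure S) : Prop :=
  exists e : univ A -> univ B, is_isomorphism e.

Definition const_ctx (L : language) (V : Type) (s : lsort L) : V -> lsort L :=
  fun _ => s.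

Record formula_seq (L : language) (N : nat) (ar : 'I_N -> nat) := FormulaSeq {
  fs_sort : lsort L;
  fs_formula : forall i, formula (@const_ctx L 'I_(ar i) fs_sort) }.

Definition seq_signature (N : nat) (ar : 'I_N -> nat) : signature :=
  {| symb := 'I_N; arity := ar |}.

(* The fixed countably infinite set of the definition of F(T) is [nat]. *)
Definition in_F (L : language) (M : structure L) (s : lsort L) (B : {fset nat})
    (f : B -> M s) : Prop :=
  injective f /\
  forall B0 : set B, B0 `<` [set: B] ->
    ~ algebraic_tp (f : env M (@const_ctx L B s))
                   ((fun b => f (set_val b)) : env M (@const_ctx L B0 s)).

Definition pulled_back (L : language) (N : nat) (ar : 'I_N -> nat)
    (phi : formula_seq L ar) (M : structure L) (B : {fset nat})
    (f : B -> M (fs_sort phi)) : rstructure (seq_signature ar) :=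
  @mk_rstructure (seq_signature ar) B
    (fun i (a : 'I_(ar i) -> B) => sat (fs_formula phi i) (f \o a)).

(* Classes of structures are predicates to [Prop] rather than [set]s for
   universe reasons. *)
Definition Age (L : language) (T : theory L) (N : nat) (ar : 'I_N -> nat)
    (phi : formula_seq L ar) : rstructure (seq_signature ar) -> Prop :=
  fun C => exists (M : structure L) (B : {fset nat})
             (f : B -> M (fs_sort phi)),
             [/\ models M T, in_F f & isomorphic C (pulled_back f)].

Definition trianglelefteq (L1 L2 : language) (T1 : theory L1)
    (T2 : theory L2) : Prop :=
  forall (N : nat) (ar : 'I_N -> nat) (phi1 : formula_seq L1 ar),
    exists phi2 : formula_seq L2 ar, forall C, Age T1 phi1 C -> Age T2 phi2 C.

Definition finite_structure (S : signature) (A : rstructure S) : Prop :=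
  finite_set [set: univ A].

(* The hereditary property is stated for embeddings, so that it includes
   closure under isomorphism. *)
Definition fraisse_class (S : signature) (K : rstructure S -> Prop) : Prop :=
  [/\ forall B, K B -> finite_structure B,
      forall B C, K B -> embedding C B -> K C,
      forall B C, K B -> K C ->
        exists D, [/\ K D, inhabited (embedding B D) &
                      inhabited (embedding C D)] &
      forall (A B C : rstructure S) (f : embedding A B) (g : embedding A C),
        K A -> K B -> K C ->
        exists (D : rstructure S) (f' : embedding B D) (g' : embedding C D),
          K D /\ forall x, sval f' (sval f x) = sval g' (sval g x)].

Definition substructure (S : signature) (A : rstructure S)
    (X : set (univ A)) : rstructure S :=
  @mk_rstructure S X
    (fun r (a : 'I_(arity r) -> X) => rrel (fun i => set_val (a i) : univ A)).

Definition ultrahomogeneous (S : signature) (A : rstructure S) : Prop :=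
  forall (X : set (univ A)) (h : embedding (substructure X) A),
    finite_set X ->
    exists g : univ A -> univ A,
      @is_isomorphism S A A g /\
      forall x : X, g (set_val x) = sval h x.

Definition generic_model (S : signature) (K : rstructure S -> Prop)
    (A : rstructure S) : Prop :=
  [/\ countable [set: univ A],
      forall B, K B <-> finite_structure B /\ inhabited (embedding B A) &
      ultrahomogeneous A].

Definition acl (S : signature) (M : rstructure S) (X : set (univ M)) :
    set (univ M) :=
  [set a : univ M | exists (n : nat) (c : 'I_n -> univ M),
     (forall i, X (c i)) /\
     algebraic_tp ((fun=> a) : env M (@const_ctx (rlang S) 'I_1 tt))
                  (c : env M (@const_ctx (rlang S) 'I_n tt))].

Definition algebraically_trivial (S : signature) (TK : theory (rlang S)) :
    Prop :=
  forall M : rstructure S, models M TK ->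
    forall X : set (univ M), acl X = X.

Definition unique_1type (S : signature) (TK : theory (rlang S)) : Prop :=
  exists p, type_space TK (@const_ctx (rlang S) 'I_1 tt) = [set p].

(* [TK] is replaced by its T^eq, as T_K itself need not eliminate
   imaginaries. *)
Definition in_C (S : signature) (TK : theory (rlang S)) (L : language)
    (T : theory L) : Prop :=
  in_TT T /\ trianglelefteq (eq_theory TK) T.

Definition order_signature (S : signature) : signature :=
  {| symb := option (symb S);
     arity := fun r => if r is Some r then arity r else 2 |}.

Definition lt_rel (S : signature) (B : rstructure (order_signature S))
    (x y : univ B) : Prop :=
  @rrel (order_signature S) B None
    (fun i : 'I_2 => if i == ord0 then x else y).

Definition reduct (S : signature) (B : rstructure (order_signature S)) :
    rstructure S :=
  @mk_rstructure S (univ B)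
    (fun r a => @rrel (order_signature S) B (Some r) a).

Definition strict_linear_order (X : Type) (lt : X -> X -> Prop) : Prop :=
  [/\ forall x, ~ lt x x, forall x y z, lt x y -> lt y z -> lt x z &
      forall x y, [\/ lt x y, x = y | lt y x]].

Definition order_class (S : signature) (K : rstructure S -> Prop) :
    rstructure (order_signature S) -> Prop :=
  fun B => [/\ finite_structure B, K (reduct B) &
               strict_linear_order (@lt_rel S B)].

Definition ramsey_property (S : signature) (K : rstructure S -> Prop) : Prop :=
  forall D B : rstructure S, K D -> K B -> forall k : nat, (0 < k)%N ->
    exists C : rstructure S, K C /\
    forall xi : embedding D C -> 'I_k,
      exists u : embedding B C,
        forall e e' : embedding D C,
          range (sval e) `<=` range (sval u) ->
          range (sval e') `<=` range (sval u) ->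
          xi e = xi e'.

Definition simply_ramsey_expandable (S : signature)
    (K : rstructure S -> Prop) : Prop := ramsey_property (order_class K).

Definition indiscernible_picture (S : signature) (A : rstructure S)
    (L : language) (M : structure L) (s : lsort L) (g : univ A -> M s) : Prop :=
  injective g /\
  forall (n : nat) (a b : 'I_n -> univ A),
    qftp (a : env A (@const_ctx (rlang S) 'I_n tt)) =
    qftp (b : env A (@const_ctx (rlang S) 'I_n tt)) ->
    tp ((g \o a) : env M (@const_ctx L 'I_n s)) =
    tp ((g \o b) : env M (@const_ctx L 'I_n s)).

Definition uncollapsed (S : signature) (A : rstructure S)
    (L : language) (M : structure L) (s : lsort L) (g : univ A -> M s) : Prop :=
  forall (n : nat) (a b : 'I_n -> univ A),
    tp ((g \o a) : env M (@const_ctx L 'I_n s)) =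
    tp ((g \o b) : env M (@const_ctx L 'I_n s)) ->
    qftp (a : env A (@const_ctx (rlang S) 'I_n tt)) =
    qftp (b : env A (@const_ctx (rlang S) 'I_n tt)).

(* Main.v *)
Require Import Defs.
From Stdlib Require List.
From mathcomp Require Import all_boot finmap.
From mathcomp Require Import boolp classical_sets functions cardinality filter.

(** Both implications move finite structures between ages by coding each element
    by a tuple of a generic model and reading relations off the atomic diagrams
    of these tuples. Since the signature is finite, a tuple of given length has
    one of finitely many diagrams. Along an un-collapsed indiscernible picture
    the diagram determines the type and conversely, so every relation that
    depends on the diagram alone is defined by a formula on the picture
    ([picture_definable]); in a theory with codes for tuples, such relations
    between tuples become relations between single elements ([sat_codes]). The
    map so obtained is in F(T) as soon as each tuple has an entry of its own:
    this entry can be moved in infinitely many ways without changing the diagram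
    ([mobile]), hence without changing the type ([picture_in_F]). The conclusion,
    [picture_age], is used twice.

    From the picture to the ordering of theories: given formulas of the
    expansion of T_K by imaginaries, the elements of a structure in their age are
    replaced by representative tuples in the generic model A; the truth of the
    formulas on these tuples only depends on their diagrams, by
    ultrahomogeneity. One private element is added to every tuple, everything is
    copied into the ordered generic model, and [picture_age] applies to the given
    picture.

    From the ordering of theories to the picture: A is an un-collapsed
    indiscernible picture of itself in its expansion by imaginaries
    ([eq_picture]). Instability gives tuples of A that are linearly ordered by an
    automorphism-invariant relation; attaching them to the elements of a copy of
    the reduct, the structures of the order class are realized in one age of the
    expansion ([order_class_age]). The hypothesis then realizes them in one age
    of T, so that the order, too, is defined by a formula of T. The Ramsey
    property makes finitely many instances of indiscernibility hold on a copy of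
    any finite structure ([ramsey_tuples]), and compactness glues these copies to
    an indiscernible picture of the ordered generic model, un-collapsed because
    all the relations are defined by formulas ([picture_exists]). *)

Set Implicit Arguments.
Unset Strict Implicit.
Unset Printing Implicit Defensive.

Local Open Scope classical_set_scope.

(** * Operations on formulas *)

Fixpoint tsubst (L : language) (V W : Type) (G : V -> lsort L) (H : W -> lsort L)
    (r : forall v, term H (G v)) (s : lsort L) (t : term G s) : term H s :=
  match t in term _ s return term H s with
  | tvar v => r v
  | tapp f args => tapp (fun i => tsubst r (args i))
  end.

Definition tweak (L : language) (V : Type) (G : V -> lsort L) (u s : lsort L)
    (t : term G s) : term (ctx_cons u G) s :=
  tsubst (fun v => tvar (ctx_cons u G) (Some v)) t.

Definition subst_cons (L : language) (V W : Type) (G : V -> lsort L)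
    (H : W -> lsort L) (u : lsort L) (r : forall v, term H (G v)) :
    forall v, term (ctx_cons u H) (ctx_cons u G v) :=
  fun o => match o with
           | Some v => tweak u (r v)
           | None => tvar (ctx_cons u H) None
           end.

Fixpoint fsubst (L : language) (V : Type) (G : V -> lsort L) (p : formula G) :
    forall (W : Type) (H : W -> lsort L), (forall v, term H (G v)) -> formula H :=
  match p with
  | f_eq s t u => fun W H r => f_eq (tsubst r t) (tsubst r u)
  | f_rel R args => fun W H r => f_rel (fun i => tsubst r (args i))
  | f_bot => fun W H r => f_bot
  | f_imp p q => fun W H r => f_imp (fsubst p r) (fsubst q r)
  | f_all s p => fun W H r => f_all (fsubst p (subst_cons s r))
  end.

Section Substitution.
Variables (L : language) (M : structure L).

Lemma eval_tsubst (V W : Type) (G : V -> lsort L) (H : W -> lsort L)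
    (r : forall v, term H (G v)) (s : lsort L) (t : term G s) (a : env M H) :
  eval a (tsubst r t) = eval (fun v => eval a (r v)) t.
Proof.
elim: t => //= f args IH; congr finterp.
by apply: functional_extensionality_dep => i; apply: IH.
Qed.

Lemma sat_fsubst (V : Type) (G : V -> lsort L) (p : formula G) (W : Type)
    (H : W -> lsort L) (r : forall v, term H (G v)) (a : env M H) :
  sat (fsubst p r) a <-> sat p (fun v => eval a (r v)).
Proof.
elim: p W H r a => {V G} [V G s t u|V G R args|V G|V G p IHp q IHq|V G s p IHp]
  W H r a //=.
- by rewrite !eval_tsubst.
- suff -> : (fun i => eval a (tsubst r (args i))) =
            (fun i => eval (fun v => eval a (r v)) (args i)) by [].
  by apply: functional_extensionality_dep => i; rewrite eval_tsubst.
- by split=> h /(IHp _ _ r a)/h/IHq.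
- have E c : (fun v => eval (env_cons c a) (subst_cons s r v)) =
             env_cons c (fun v => eval a (r v)).
    by apply: functional_extensionality_dep => -[v|] //=; rewrite eval_tsubst.
  by split=> h c; have := h c; rewrite IHp E.
Qed.

End Substitution.

Definition f_and (L : language) (V : Type) (G : V -> lsort L) (p q : formula G) :=
  f_not (f_imp p (f_not q)).

Definition f_ex (L : language) (V : Type) (G : V -> lsort L) (s : lsort L)
    (p : formula (ctx_cons s G)) : formula G := f_not (f_all (f_not p)).

Definition f_const (L : language) (V : Type) (G : V -> lsort L) (P : Prop) :
    formula G := if pselect P then f_not f_bot else f_bot.

Definition f_conj (L : language) (V : Type) (G : V -> lsort L) (X : finType)
    (F : X -> formula G) : formula G :=
  foldr (fun x p => f_and (F x) p) (f_not f_bot) (enum X).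

Definition f_disj (L : language) (V : Type) (G : V -> lsort L) (X : finType)
    (F : X -> formula G) : formula G := f_not (f_conj (fun x => f_not (F x))).

(** Between constant contexts, a renaming of variables needs no transport of
    sorts. *)
Definition frename (L : language) (s : lsort L) (V W : Type) (r : V -> W)
    (p : formula (@const_ctx L V s)) : formula (@const_ctx L W s) :=
  fsubst p (fun v => tvar (@const_ctx L W s) (r v)).

Section Connectives.
Variables (L : language) (M : structure L) (V : Type) (G : V -> lsort L).
Implicit Types (p q : formula G) (a : env M G).

Lemma sat_not p a : sat (f_not p) a <-> ~ sat p a.
Proof. by []. Qed.

Lemma sat_and p q a : sat (f_and p q) a <-> sat p a /\ sat q a.
Proof.
split=> [h|[h1 h2] h] /=; last exact: h.
by split; apply: contrapT => n; apply: h => h1 h2.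
Qed.

Lemma sat_ex s (p : formula (ctx_cons s G)) a :
  sat (f_ex p) a <-> exists c : M s, sat p (env_cons c a).
Proof.
split=> [h|[c hc] h] /=; last exact: (h c).
by apply: contrapT => n; apply: h => c hc; apply: n; exists c.
Qed.

Lemma sat_const (P : Prop) a : sat (f_const G P) a <-> P.
Proof. by rewrite /f_const; case: pselect => hP /=; tauto. Qed.

Lemma sat_conj (X : finType) (F : X -> formula G) a :
  sat (f_conj F) a <-> forall x, sat (F x) a.
Proof.
suff E (s : seq X) : sat (foldr (fun x p => f_and (F x) p) (f_not f_bot) s) a
                     <-> forall x, x \in s -> sat (F x) a.
  rewrite /f_conj E; split=> h x *; apply: h => //.
  by rewrite mem_enum.
elim: s => [|x s IH]; first by split=> // _ [].
change (sat (f_and (F x)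
         (foldr (fun x p => f_and (F x) p) (f_not f_bot) s)) a
  <-> forall y, y \in x :: s -> sat (F y) a).
rewrite sat_and IH; split=> [[h1 h2] y|h].
  by rewrite inE => /orP[/eqP->|/h2].
by split=> [|y ys]; apply: h; rewrite inE ?eqxx// ys orbT.
Qed.

Lemma sat_disj (X : finType) (F : X -> formula G) a :
  sat (f_disj F) a <-> exists x, sat (F x) a.
Proof.
rewrite /f_disj sat_not sat_conj; split=> [h|[x hx] h]; last exact: (h x).
by apply: contrapT => n; apply: h => x hx; apply: n; exists x.
Qed.

End Connectives.

(** Disjunctive normal form. The finiteness of the signature is turned into
    definability by this lemma. *)
Lemma definable_boolean (L : language) (V : Type) (G : V -> lsort L)
    (X : finType) (F : X -> formula G) (P : {ffun X -> bool} -> Prop) :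
  exists p : formula G, forall (M : structure L) (a : env M G),
    sat p a <-> P [ffun x => `[< sat (F x) a >]].
Proof.
exists (f_disj (fun v : {ffun X -> bool} => f_and (f_const G (P v))
  (f_conj (fun x => if v x then F x else f_not (F x))))) => M a.
rewrite sat_disj; split=> [[v]|h].
  rewrite sat_and sat_const sat_conj => -[Pv hv].
  suff -> : [ffun x => `[< sat (F x) a >]] = v by [].
  apply/ffunP => x; rewrite ffunE; apply/asboolP; have := hv x.
  by case: (v x).
exists [ffun x => `[< sat (F x) a >]]; rewrite sat_and sat_const sat_conj.
by split=> // x; rewrite ffunE; case: asboolP.
Qed.

Lemma sat_frename (L : language) (M : structure L) (s : lsort L) (V W : Type)
    (r : V -> W) (p : formula (@const_ctx L V s)) (a : W -> M s) :
  sat (frename r p) (a : env M (@const_ctx L W s)) <->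
  sat p (a \o r : env M (@const_ctx L V s)).
Proof. exact: sat_fsubst. Qed.

Definition f_tuple_eq (L : language) (V : finType) (G : V -> lsort L) :
    formula (ctx_cat G G) :=
  f_conj (fun v => f_eq (tvar (ctx_cat G G) (inl v)) (tvar (ctx_cat G G) (inr v))).

Lemma sat_tuple_eq (L : language) (M : structure L) (V : finType)
    (G : V -> lsort L) (a b : env M G) :
  sat (f_tuple_eq G) (env_cat a b) <-> a = b.
Proof.
rewrite sat_conj; split=> [h|-> //].
by apply: functional_extensionality_dep => v; apply: (h v).
Qed.

Lemma tuple_eq_equivalence (L : language) (T : theory L) (n : nat)
    (G : 'I_n -> lsort L) : definable_equivalence T (f_tuple_eq G).
Proof. by move=> M _; split=> [x|x y|x y z]; rewrite !sat_tuple_eq // => -> ->. Qed.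

(** ** Quantification over a finite block of variables *)

Section Blocks.
Variable L : language.

(** The sorts of a block of variables form a family indexed by the block, so the
    separation of its first variable from the other ones acts on types. *)
Definition ord_cases (n : nat) (P : 'I_n.+1 -> Type) (P0 : P ord0)
    (PS : forall j, P (lift ord0 j)) (i : 'I_n.+1) : P i :=
  match unliftP ord0 i with
  | UnliftSome j e => eq_rect_r P (PS j) e
  | UnliftNone e => eq_rect_r P P0 e
  end.

Lemma ord_cases_nat (n : nat) (P Q : 'I_n.+1 -> Type) (f : forall i, P i -> Q i)
    P0 PS (b : forall i, Q i) :
  f ord0 P0 = b ord0 -> (forall j, f _ (PS j) = b (lift ord0 j)) ->
  forall i, f i (@ord_cases n P P0 PS i) = b i.
Proof.
move=> h0 hS i; rewrite /ord_cases; case: (unliftP ord0 i) => [j e|e]; subst i.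
  exact: hS.
exact: h0.
Qed.

Lemma ex_block_ord (n : nat) (V : Type) (G : V -> lsort L) (H : 'I_n -> lsort L)
    (p : formula (ctx_cat G H)) :
  exists q : formula G, forall (M : structure L) (a : env M G),
    sat q a <-> exists b : env M H, sat p (env_cat a b).
Proof.
elim: n V G H p => [|n IH] V G H p.
  pose r (v : V + 'I_0) : term G (ctx_cat G H v) :=
    match v return term G (ctx_cat G H v) with
    | inl v => tvar G v
    | inr i => False_rect _ (notF (ltn_ord i))
    end.
  exists (fsubst p r) => M a; rewrite sat_fsubst.
  have E (b : env M H) : (fun v => eval a (r v)) = env_cat a b.
    by apply: functional_extensionality_dep => -[v|[]].
  split=> [h|[b]]; last by rewrite (E b).
  have b : env M H by case.
  by exists b; rewrite -(E b).
pose H' j := H (lift ord0 j); pose G' := ctx_cons (H ord0) G.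
pose r (v : V + 'I_n.+1) : term (ctx_cat G' H') (ctx_cat G H v) :=
  match v return term (ctx_cat G' H') (ctx_cat G H v) with
  | inl v => tvar (ctx_cat G' H') (inl (Some v))
  | inr i => @ord_cases n (fun i => term (ctx_cat G' H') (H i))
     (tvar (ctx_cat G' H') (inl None)) (fun j => tvar (ctx_cat G' H') (inr j)) i
  end.
have [q hq] := IH _ G' H' (fsubst p r).
exists (f_ex q) => M a; rewrite sat_ex.
have E (b : env M H) :
    (fun v => eval (env_cat (env_cons (b ord0) a : env M G')
                   ((fun j => b (lift ord0 j)) : env M H')) (r v)) = env_cat a b.
  apply: functional_extensionality_dep => -[v|i] //.
  exact: (@ord_cases_nat _ (fun i => term _ (H i)) (fun i => M (H i))
           (fun i t => eval _ t) _ _ b).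
split=> [[c /hq[b']]|[b hb]]; last first.
  exists (b ord0); apply/hq; exists (fun j => b (lift ord0 j)).
  by apply/sat_fsubst; rewrite E.
rewrite sat_fsubst => h.
pose b : env M H := @ord_cases n (fun i => M (H i)) c b'.
exists b; rewrite -E.
have e0 : b ord0 = c.
  rewrite /b /ord_cases; case: (unliftP ord0 ord0) => [j e|e].
    by have /eqP := e; rewrite (negbTE (neq_lift _ _)).
  by rewrite (eq_irrelevance e (erefl _)).
have eS : (fun j => b (lift ord0 j)) = b'.
  apply: functional_extensionality_dep => j; rewrite /b /ord_cases.
  case: (unliftP ord0 (lift ord0 j)) => [k e|e]; last first.
    by have /eqP := esym e; rewrite (negbTE (neq_lift _ _)).
  have ek := lift_inj e; subst k.
  by rewrite (eq_irrelevance e (erefl _)).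
by rewrite e0 eS.
Qed.

(** Blocks indexed by an arbitrary finite type reduce to numbered ones. *)
Lemma ex_block (W : finType) (V : Type) (G : V -> lsort L) (H : W -> lsort L)
    (p : formula (ctx_cat G H)) :
  exists q : formula G, forall (M : structure L) (a : env M G),
    sat q a <-> exists b : env M H, sat p (env_cat a b).
Proof.
pose H' (i : 'I_#|W|) := H (enum_val i).
pose r (v : V + W) : term (ctx_cat G H') (ctx_cat G H v) :=
  match v return term (ctx_cat G H') (ctx_cat G H v) with
  | inl v => tvar (ctx_cat G H') (inl v)
  | inr w => eq_rect _ (fun w => term (ctx_cat G H') (H w))
      (tvar (ctx_cat G H') (inr (enum_rank w))) w (enum_rankK w)
  end.
have [q hq] := ex_block_ord (fsubst p r).
exists q => M a; rewrite hq.
have E (b : env M H) : (fun v => eval (env_cat a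
       ((fun i => b (enum_val i)) : env M H')) (r v)) = env_cat a b.
  apply: functional_extensionality_dep => -[v|w] //=.
  by move: (enum_rankK w); move: (enum_rank w) => k e; case: _ / e.
split=> [[b']|[b hb]]; last first.
  by exists (fun i => b (enum_val i)); apply/sat_fsubst; rewrite E.
pose b : env M H := fun w => eq_rect _ (fun w => M (H w)) (b' (enum_rank w)) w
  (enum_rankK w).
move/sat_fsubst => h; exists b; rewrite -E.
suff -> : (fun i => b (enum_val i)) = b' by [].
apply: functional_extensionality_dep => i; rewrite /b.
move: (enum_rankK (enum_val i)); rewrite enum_valK => e.
by rewrite (eq_irrelevance e (erefl _)).
Qed.

(** Truth of an existential statement with finitely many variables is expressed
    by a sentence, uniformly in the structure; this is how configurations are
    transferred between elementarily equivalent structures. *)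
Lemma ex_closure (W : finType) (H : W -> lsort L) (p : formula H) :
  exists q : sentence L, forall M : structure L,
    holds M q <-> exists b : env M H, sat p b.
Proof.
pose r w := tvar (ctx_cat (@ctx_nil (lsort L)) H) (inr w).
have [q hq] := ex_block (fsubst p r : formula (ctx_cat (@ctx_nil _) H)).
exists q => M; rewrite /holds hq.
by split=> -[b h]; exists b; move: h; rewrite sat_fsubst.
Qed.

End Blocks.

(** * Compactness *)

Section Ultraproduct.
Variables (L : language) (I : Type) (F : set_system I).
Hypothesis FU : UltraFilter F.
Variable M : I -> structure L.

Let eqv (s : lsort L) (x y : forall i, M i s) := F [set i | x i = y i].

Definition up_carrier (s : lsort L) : Type :=
  {X : set (forall i, M i s) | exists x, X = eqv x}.

Definition up_class (s : lsort L) (x : forall i, M i s) : up_carrier s :=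
  exist _ (eqv x) (ex_intro _ x erefl).

Definition up_repr (s : lsort L) (X : up_carrier s) : forall i, M i s :=
  sval (cid (svalP X)).

Lemma up_reprK (s : lsort L) (X : up_carrier s) : up_class (up_repr X) = X.
Proof.
by case: X => X h; apply: eq_exist; rewrite /up_repr; case: cid => x /= ->.
Qed.

Lemma up_classP (s : lsort L) (x y : forall i, M i s) :
  up_class x = up_class y <-> F [set i | x i = y i].
Proof.
have e : forall x : forall i, M i s, eqv x x by move=> z; apply: filterS filterT.
split=> [[exy]|h]; first by have := e y; rewrite -exy.
apply: eq_exist; rewrite predeqE => z; split; apply: filterS2 h => i /=.
  by move=> -> ->.
by move=> -> ->.
Qed.

Lemma up_classK (s : lsort L) (x : forall i, M i s) :
  F [set i | up_repr (up_class x) i = x i].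
Proof. by apply/up_classP; rewrite up_reprK. Qed.

Definition ultraproduct : structure L :=
  {| carrier := up_carrier;
     finterp := fun f args =>
       up_class (fun i => finterp (fun k => up_repr (args k) i));
     rinterp := fun r args =>
       F [set i | rinterp (fun k => up_repr (args k) i)] |}.

Lemma up_class_tuple (n : nat) (G : 'I_n -> lsort L) (x : forall k i, M i (G k)) :
  F [set i | (fun k => up_repr (up_class (x k)) i) = (fun k => x k i)].
Proof.
have h : F [set i | forall k, up_repr (up_class (x k)) i = x k i].
  exact: (@filter_forall I 'I_n
    (fun k => [set i | up_repr (up_class (x k)) i = x k i]) F _
    (fun k => up_classK (x k))).
by apply: filterS h => i /= h; apply: functional_extensionality_dep.
Qed.

Lemma up_eval (V : Type) (G : V -> lsort L) (x : forall v i, M i (G v))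
    (s : lsort L) (t : term G s) :
  eval ((fun v => up_class (x v)) : env ultraproduct G) t =
  up_class (fun i => eval (fun v => x v i) t).
Proof.
elim: t => // f args IH.
transitivity (@finterp L ultraproduct f
                (fun k => up_class (fun i => eval (fun v => x v i) (args k)))).
  rewrite /=; congr up_class; apply: functional_extensionality_dep => i.
  congr finterp; apply: functional_extensionality_dep => k.
  by congr (up_repr _ i); apply: IH.
apply/up_classP.
by apply: filterS (up_class_tuple (fun k i => eval (fun v => x v i) (args k)))
  => i /= ->.
Qed.

Lemma ultra_imp (P Q : set I) : F [set i | P i -> Q i] <-> (F P -> F Q).
Proof.
split=> [h hP|h]; first by apply: filterS2 h hP => i /= h; apply: h.
have [/h|] := in_ultra_setVsetC P FU; first by apply: filterS => i /=.
by apply: filterS => i /= nP /nP.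
Qed.

(** Łoś's theorem; the sorts have to be inhabited to choose a counterexample
    to a universal statement simultaneously in all the factors. *)
Lemma los (M_inh : forall i s, inhabited (M i s)) (V : Type) (G : V -> lsort L)
    (p : formula G) (x : forall v i, M i (G v)) :
  sat p ((fun v => up_class (x v)) : env ultraproduct G) <->
  F [set i | sat p (fun v => x v i)].
Proof.
elim: p x => {V G} [V G s t u|V G r args|V G|V G p IHp q IHq|V G s p IHp] x.
- by rewrite /= !up_eval up_classP.
- have -> : sat (f_rel args) ((fun v => up_class (x v)) : env ultraproduct G) =
    F [set i | rinterp
     (fun k => up_repr (up_class (fun i => eval (fun v => x v i) (args k))) i)].
    rewrite /=; congr (F _); apply: funext => i; congr rinterp.
    by apply: functional_extensionality_dep => k; rewrite up_eval.
  have h := up_class_tuple (fun k i => eval (fun v => x v i) (args k)).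
  by split=> h1; apply: filterS2 h h1 => i /= ->.
- by split=> //= h; apply: (filter_not_empty F); apply: filterS h.
- by rewrite /= IHp IHq -ultra_imp.
- pose xc (y : forall i, M i s) o : forall i, M i (ctx_cons s G o) :=
    match o with Some v => x v | None => y end.
  have E y : env_cons (up_class y : ultraproduct s) ((fun v => up_class (x v)) :
      env ultraproduct G) = (fun o => up_class (xc y o)).
    by apply: functional_extensionality_dep => -[v|].
  have E' y i : (fun o => xc y o i) = env_cons (y i) (fun v => x v i).
    by apply: functional_extensionality_dep => -[v|].
  split=> [h|h c]; last first.
    rewrite -(up_reprK c) E; apply/(IHp (xc _)); apply: filterS h => i /= h.
    by rewrite E'; apply: h.
  apply: contrapT => nF.
  pose bad i (c : M i s) := ~ sat p (env_cons c (fun v => x v i)).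
  have wit i : {c : M i s | (exists c, bad i c) -> bad i c}.
    apply: cid; have [[c hc]|n] := pselect (exists c, bad i c); first by exists c.
    by have [c] := M_inh i s; exists c.
  have := h (up_class (fun i => sval (wit i))).
  rewrite E => /(IHp (xc _)) hF; apply: nF; apply: filterS hF => i /=.
  rewrite E' => hi c; apply: contrapT => nc.
  by apply: (svalP (wit i)) hi; exists c.
Qed.

End Ultraproduct.

(** The factors of the ultraproduct are indexed by the finite lists of formulas
    of [Sigma], and the ultrafilter contains, for each list, the set of the lists
    that include it. *)
Lemma compactness (L : language) (T : theory L) (V : Type) (G : V -> lsort L)
    (Sigma : set (formula G)) :
  (forall l : seq (formula G), (forall p, List.In p l -> Sigma p) ->
     exists (M : structure L) (a : env M G),
       models M T /\ forall p, List.In p l -> sat p a) ->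
  exists (M : structure L) (a : env M G),
    models M T /\ forall p, Sigma p -> sat p a.
Proof.
move=> fin.
pose I := {l : seq (formula G) | forall p, List.In p l -> Sigma p}.
have w (l : I) : {M : structure L & {a : env M G |
    models M T /\ forall p, List.In p (sval l) -> sat p a}}.
  by have /cid[M /cid h] := fin (sval l) (svalP l); exists M.
pose M l := projT1 (w l); pose a l : env (M l) G := sval (projT2 (w l)).
have aP l : models (M l) T /\ forall p, List.In p (sval l) -> sat p (a l).
  exact: (svalP (projT2 (w l))).
pose cone (l : I) : set I := [set l' | forall p, List.In p (sval l) ->
  List.In p (sval l')].
have coneF : ProperFilter (filter_from setT cone).
  apply: filter_from_proper; last by move=> l _; exists l.
  apply: filter_from_filter.
    have h0 p : List.In p [::] -> Sigma p by [].
    by exists (exist _ _ h0).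
  move=> l1 l2 _ _.
  have h p : List.In p (sval l1 ++ sval l2)%SEQ -> Sigma p.
    by move=> /(@List.in_app_or _ _ _ _)[]; [exact: (svalP l1)|exact: (svalP l2)].
  exists (exist _ _ h) => // l' /= hl'.
  by split=> p hp; apply: hl'; apply: List.in_or_app; [left|right].
have [F [FU subF]] := ultraFilterLemma coneF.
have inh l s : inhabited (M l s) by have [[]] := aP l.
exists (ultraproduct F M), (fun v => up_class F (fun l => a l v)).
split; [split|].
- move=> s; constructor; apply: (up_class F) => l.
  exact: (inhabited_witness (inh l s)).
- move=> p Tp; rewrite /holds.
  have -> : env_nil (ultraproduct F M) =
     (fun v => up_class F (fun i => env_nil (M i) v)).
    by apply: functional_extensionality_dep => -[].
  apply/los => //; apply: filterS filterT => l _ /=.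
  exact: (aP l).1.2 p Tp.
move=> p Sp; apply/los => //.
have h q : List.In q [:: p] -> Sigma q by case=> // <-.
have := subF (cone (exist _ _ h)).
move/(_ (ex_intro2 _ _ _ Logic.I (fun _ => id))).
by apply: filterS => l /= /(_ p (or_introl erefl)); apply: (aP l).2.
Qed.

(** * Atomic diagrams of tuples *)

Section Tuples.
Variable S : signature.
Implicit Types A B : rstructure S.

(** Quantifier-free types are compared through this relation, which makes sense
    for tuples indexed by any type and across structures. *)
Definition same_atoms A B (V : Type) (a : V -> univ A) (b : V -> univ B) : Prop :=
  (forall v w, a v = a w <-> b v = b w) /\
  (forall (r : symb S) (c : 'I_(arity r) -> V), rrel (a \o c) <-> rrel (b \o c)).

Lemma same_atoms_sym A B (V : Type) (a : V -> univ A) (b : V -> univ B) :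
  same_atoms a b -> same_atoms b a.
Proof.
move=> [h1 h2]; split=> [v w|r c]; split.
- by move/h1.
- by move/h1.
- by move/h2.
- by move/h2.
Qed.

Lemma same_atoms_trans A B (C : rstructure S) (V : Type) (a : V -> univ A)
    (b : V -> univ B) (c : V -> univ C) :
  same_atoms a b -> same_atoms b c -> same_atoms a c.
Proof.
move=> [h1 h2] [h3 h4]; split=> [v w|r d]; split.
- by move/h1/h3.
- by move/h3/h1.
- by move/h2/h4.
- by move/h4/h2.
Qed.

Lemma same_atoms_comp A B (V W : Type) (f : W -> V) (a : V -> univ A)
    (b : V -> univ B) : same_atoms a b -> same_atoms (a \o f) (b \o f).
Proof. by move=> [h1 h2]; split=> [v w|r c]; [exact: h1|exact: (h2 r (f \o c))]. Qed.

Lemma same_atoms_embedding A B (V : Type) (a : V -> univ A)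
    (e : univ A -> univ B) : is_embedding e -> same_atoms a (e \o a).
Proof.
move=> [inj h]; split=> [v w|r c] /=; last exact: h.
by split=> [->//|/inj].
Qed.

(** The sort type of a one-sorted language is a unit type, over which contexts
    are only propositionally constant; [uenv] is the conversion, and computes to
    the identity on constant contexts. *)
Definition to_sort A (s : lsort (rlang S)) (x : univ A) : A s :=
  match s with tt => x end.

Definition uenv A (V : Type) (G : V -> lsort (rlang S)) (a : V -> univ A) :
  env A G := fun v => to_sort (G v) (a v).

Lemma uenv_surj A (V : Type) (G : V -> lsort (rlang S)) (e : env A G) :
  exists a : V -> univ A, e = uenv G a.
Proof.
pose un (s : lsort (rlang S)) : A s -> univ A :=
  match s return A s -> univ A with tt => id end.
exists (fun v => un _ (e v)); apply: functional_extensionality_dep => v.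
by rewrite /uenv; move: (e v); case: (G v).
Qed.

Lemma uenv_cons A (V : Type) (G : V -> lsort (rlang S)) s (c : univ A)
    (a : V -> univ A) :
  env_cons (to_sort s c) (uenv G a) =
  uenv (ctx_cons s G) (fun o => if o is Some v then a v else c).
Proof. by apply: functional_extensionality_dep => -[]. Qed.

Definition var_of (V : Type) (G : V -> lsort (rlang S)) s (t : term G s) : V :=
  match t with
  | tvar v => v
  | tapp f _ => match f with end
  end.

Lemma eval_uenv A (V : Type) (G : V -> lsort (rlang S)) s (t : term G s)
    (a : V -> univ A) : eval (uenv G a) t = to_sort s (a (var_of t)).
Proof. by case: t => // -[]. Qed.

Lemma to_sort_inj A s (x y : univ A) : to_sort s x = to_sort s y <-> x = y.
Proof. by split=> [|->//]; case: s. Qed.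

Lemma sat_rel_uenv A (V : Type) (G : V -> lsort (rlang S)) (r : symb S)
    (args : forall i, term G (@rdom (rlang S) r i)) (a : V -> univ A) :
  sat (f_rel args) (uenv G a) <-> rrel (fun i => a (var_of (args i))).
Proof.
rewrite /= /rrel.
suff -> : (fun i => eval (uenv G a) (args i)) = (fun i => a (var_of (args i))) by [].
by apply: functional_extensionality_dep => i; rewrite eval_uenv.
Qed.

Lemma sat_quantifier_free A B (V : Type) (G : V -> lsort (rlang S)) (p : formula G)
    (a : V -> univ A) (b : V -> univ B) :
  quantifier_free p -> same_atoms a b -> sat p (uenv G a) <-> sat p (uenv G b).
Proof.
elim: p a b => {V G} [V G s t u|V G r args|V G|V G p IHp q IHq|V G s p IHp] a b //.
- by move=> _ [h _]; rewrite /= !eval_uenv !to_sort_inj.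
- by move=> _ [_ h]; rewrite !sat_rel_uenv; apply: (h r (fun i => var_of (args i))).
- move=> [hp hq] ab.
  by split=> h /(IHp _ _ hp ab)/h/(IHq _ _ hq ab).
Qed.

Lemma sat_isomorphism A B (V : Type) (G : V -> lsort (rlang S)) (p : formula G)
    (a : V -> univ A) (g : univ A -> univ B) :
  is_isomorphism g -> sat p (uenv G a) <-> sat p (uenv G (g \o a)).
Proof.
move=> [emb [g' _ gK]].
elim: p a => {V G} [V G s t u|V G r args|V G|V G p IHp q IHq|V G s p IHp] a //.
- exact/sat_quantifier_free/same_atoms_embedding.
- exact/sat_quantifier_free/same_atoms_embedding.
- by split=> h /IHp/h/IHq.
- split=> h c.
    have [c' ->] : exists c', c = to_sort s (g c').
      by case: s p IHp h c => p _ _ c; exists (g' c); rewrite /= gK.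
    have := h (to_sort s c'); rewrite !uenv_cons => /IHp.
    by congr sat; apply: functional_extensionality_dep => -[].
  have [c' ->] : exists c', c = to_sort s c' by case: s c {p IHp h} => c; exists c.
  have := h (to_sort s (g c')); rewrite !uenv_cons => h'; apply/IHp.
  move: h'; congr sat; apply: functional_extensionality_dep => -[] //.
Qed.

Lemma qftp_same_atoms A B (n : nat) (a : 'I_n -> univ A) (b : 'I_n -> univ B) :
  qftp (a : env A (@const_ctx (rlang S) 'I_n tt)) =
  qftp (b : env B (@const_ctx (rlang S) 'I_n tt)) <-> same_atoms a b.
Proof.
split=> [h|h]; last first.
  rewrite predeqE => p; split=> -[qf hp]; split=> //.
    exact/(sat_quantifier_free qf h).
  exact/(sat_quantifier_free qf h).
have {}h p : quantifier_free p -> sat p (a : env A (@const_ctx (rlang S) 'I_n tt))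
    <-> sat p (b : env B (@const_ctx (rlang S) 'I_n tt)).
  move: h; rewrite predeqE => /(_ p) h qf.
  by split=> hp; have [h1 h2] := h; [case: h1|case: h2].
pose x := tvar (@const_ctx (rlang S) 'I_n tt).
split=> [v w|r c]; first exact: (h (f_eq (x v) (x w)) Logic.I).
exact: (h (@f_rel (rlang S) _ _ r (fun i => x (c i))) Logic.I).
Qed.

(** The atoms of a finite tuple form a finite type, because the signature is
    finite: a tuple has one of finitely many diagrams. *)
Definition atom (I : finType) : finType :=
  (I * I + {r : symb S & {ffun 'I_(arity r) -> I}})%type.

Definition atom_holds A (I : finType) (a : I -> univ A) (x : atom I) : Prop :=
  match x with
  | inl ij => a ij.1 = a ij.2
  | inr rc => rrel (fun k => a (tagged rc k))
  end.

Definition diag A (I : finType) (a : I -> univ A) : {ffun atom I -> bool} :=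
  [ffun x => `[< atom_holds a x >]].

Lemma diagP A B (I : finType) (a : I -> univ A) (b : I -> univ B) :
  diag a = diag b <-> same_atoms a b.
Proof.
split=> [/ffunP h|[h1 h2]].
  have {}h x : atom_holds a x <-> atom_holds b x.
    have := h x; rewrite !ffunE => e.
    by split=> hx; apply/asboolP; [rewrite -e|rewrite e]; apply/asboolP.
  split=> [v w|r c]; first exact: (h (inl (v, w))).
  have -> : c = (finfun c : {ffun _ -> _}) by apply: funext => k; rewrite ffunE.
  exact: (h (inr (Tagged (fun r => {ffun 'I_(arity r) -> I}) (finfun c)))).
apply/ffunP => x; rewrite !ffunE; apply/asboolP/asboolP.
  by case: x => [[i j]|[r c]] /= => [/h1|/(h2 r c)].
by case: x => [[i j]|[r c]] /= => [/h1|/(h2 r c)].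
Qed.

(** The embedding that ultrahomogeneity extends is defined on the range of [a];
    it is well defined because diagrams record the equalities between entries. *)
Lemma ultrahomogeneous_tuple A (I : finType) (a b : I -> univ A) :
  ultrahomogeneous A -> same_atoms a b ->
  exists g : univ A -> univ A, is_isomorphism g /\ forall i, g (a i) = b i.
Proof.
move=> hom [h1 h2].
have wit (x : range a) : {i : I | a i = set_val x}.
  by apply: cid; have [i _ ai] := set_mem (valP x); exists i.
pose h x : univ A := b (sval (wit x)).
have hE i (x : range a) : set_val x = a i -> h x = b i.
  by move=> xi; apply/h1; rewrite (svalP (wit x)).
have emb : @is_embedding S (substructure (range a)) A h.
  split=> [x y /h1|r c].
    by rewrite (svalP (wit x)) (svalP (wit y)) => /val_inj.
  have -> : h \o c = b \o (fun k => sval (wit (c k))) by [].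
  rewrite -h2 /rrel /=; suff -> : a \o (fun k => sval (wit (c k))) =
    (fun k => set_val (c k)) by [].
  by apply: funext => k /=; rewrite (svalP (wit (c k))).
have fin : finite_set (range a) by apply: finite_image.
have [g [iso gE]] := hom _ (exist _ h emb) fin.
exists g; split=> // i.
have xi : a i \in range a by apply/mem_set; exists i.
by have := gE (exist _ (a i) xi); rewrite /= => ->; apply: hE.
Qed.

End Tuples.

(** * Ages witnessed by pictures *)

(** The index types are finite sets of natural numbers, since these are the
    domains of the maps in F(T). *)
Lemma finite_set_tuple (X : Type) (W : set X) : finite_set W ->
  exists (B : {fset nat}) (w : B -> X), injective w /\
    forall x, W x <-> exists b, w b = x.
Proof.
move=> fin; have [f finj] := pcard_injP (finite_set_countable fin).
have fimg : finite_set (f @` W) by apply: finite_image.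
have wit (b : fset_set (f @` W)) : {x | W x /\ f x = val b}.
  apply: cid; have := valP b; rewrite in_fset_set// inE => -[x Wx xb].
  by exists x.
exists (fset_set (f @` W)), (fun b => sval (wit b)); split=> [b b' e|x].
  by apply: val_inj; rewrite -(svalP (wit b)).2 -(svalP (wit b')).2 e.
split=> [Wx|[b <-]]; last exact: (svalP (wit b)).1.
have fx : f x \in fset_set (f @` W) by rewrite in_fset_set// inE; exists x.
exists (FSetSub fx); have [Wx' e] := svalP (wit (FSetSub fx)).
by apply: finj; rewrite ?inE.
Qed.

Lemma finite_fset_bij (X : Type) : finite_set [set: X] ->
  exists (B : {fset nat}) (e : X -> B) (e' : B -> X), cancel e e' /\ cancel e' e.
Proof.
move=> /finite_set_tuple[B [w [winj /(_ _)]]] => wE.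
have /choice[e eK] : forall x, exists b, w b = x by move=> x; apply/wE.
by exists B, e, w; split=> // b; apply: winj.
Qed.

Definition upd (I : eqType) (X : Type) (y : I -> X) (i : I) (z : X) : I -> X :=
  fun j => if j == i then z else y j.

(** A form of triviality of algebraic closure that only speaks of diagrams: an
    entry of a finite tuple different from the other ones can be moved off any
    finite set. *)
Definition mobile (S : signature) (A : rstructure S) : Prop :=
  forall (I : finType) (y : I -> univ A) (i : I),
    (forall j, j != i -> y j <> y i) ->
    forall F : set (univ A), finite_set F ->
      exists z, ~ F z /\ same_atoms (upd y i z) y.

(** Codes in one sort for the tuples of elements of another sort, as provided
    by elimination of imaginaries. *)
Definition coding (L : language) (M : structure L) (s s' : lsort L) (J : finType)
    (h : (J -> M s) -> M s') : Prop :=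
  injective h /\
  exists p : formula (ctx_cons s' (@const_ctx L J s)),
    forall (a : env M (@const_ctx L J s)) c, sat p (env_cons c a) <-> h a = c.

Section Coding.
Variables (L : language) (M : structure L) (s s' : lsort L) (J : finType).
Variable h : (J -> M s) -> M s'.
Hypothesis hh : coding h.

Definition codes (R : Type) (z : R * J -> M s) : R -> M s' :=
  fun i => h (fun j => z (i, j)).

Lemma coding_graph (R : Type) :
  exists gr : R -> formula (ctx_cat (@const_ctx L R s') (@const_ctx L (R * J) s)),
    forall i (x : env M (@const_ctx L R s')) (z : env M (@const_ctx L (R * J) s)),
      sat (gr i) (env_cat x z) <-> h (fun j => z (i, j)) = x i.
Proof.
have [_ [p hp]] := hh.
pose G := ctx_cat (@const_ctx L R s') (@const_ctx L (R * J) s).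
pose r i (o : option J) : term G (ctx_cons s' (@const_ctx L J s) o) :=
  match o return term G (ctx_cons s' (@const_ctx L J s) o) with
  | Some j => tvar G (inr (i, j))
  | None => tvar G (inl i)
  end.
exists (fun i => fsubst p (r i)) => i x z.
rewrite sat_fsubst -hp.
suff -> : (fun v => eval (env_cat x z) (r i v)) = env_cons (x i) (fun j => z (i, j)).
  by [].
by apply: functional_extensionality_dep => -[].
Qed.

(** The tuple is recovered from its code, as the coding is injective with a
    definable graph; hence formulas travel in both directions between tuples and
    codes. *)
Lemma sat_codes (R : finType) (p : formula (@const_ctx L (R * J)%type s)) :
  exists q : formula (@const_ctx L R s'), forall z : R * J -> M s,
    sat q (codes z : env M (@const_ctx L R s')) <->
    sat p (z : env M (@const_ctx L (R * J)%type s)).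
Proof.
have [gr grP] := coding_graph R.
pose G := ctx_cat (@const_ctx L R s') (@const_ctx L (R * J) s).
pose p' := fsubst p (fun v => tvar G (inr v)).
have [q hq] := ex_block (f_and (f_conj gr) p').
exists q => z; rewrite hq; split=> [[z']|hp].
  rewrite sat_and sat_conj => -[hgr]; rewrite sat_fsubst => hz'.
  suff -> : z = z' by [].
  apply: funext => -[i j]; have := hgr i; rewrite grP => /hh.1 e.
  by have := congr1 (fun f => f j) e => /= ->.
exists z; rewrite sat_and sat_conj sat_fsubst; split=> // i.
by rewrite grP.
Qed.

Lemma sat_codes_pullback (R : finType) (q : formula (@const_ctx L R s')) :
  exists p : formula (@const_ctx L (R * J)%type s), forall z : R * J -> M s,
    sat p (z : env M (@const_ctx L (R * J)%type s)) <->
    sat q (codes z : env M (@const_ctx L R s')).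
Proof.
have [gr grP] := coding_graph R.
pose G := ctx_cat (@const_ctx L (R * J) s) (@const_ctx L R s').
pose flip v : term G (ctx_cat (@const_ctx L R s') (@const_ctx L (R * J) s) v) :=
  match v return term G (ctx_cat (@const_ctx L R s') (@const_ctx L (R * J) s) v)
  with inl i => tvar G (inr i) | inr ij => tvar G (inl ij) end.
pose q' := fsubst q (fun v => tvar G (inr v)).
have [p hp] := ex_block (f_and (f_conj (fun i => fsubst (gr i) flip)) q').
have E (z : R * J -> M s) (x : R -> M s') : (fun v => eval (env_cat
    (z : env M (@const_ctx L (R * J) s)) (x : env M (@const_ctx L R s'))) (flip v))
    = env_cat (x : env M (@const_ctx L R s')) (z : env M (@const_ctx L (R * J) s)).
  by apply: functional_extensionality_dep => -[].
exists p => z; rewrite hp; split=> [[x]|hq].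
  rewrite sat_and sat_conj => -[hgr]; rewrite sat_fsubst => hx.
  suff -> : codes z = x by [].
  by apply: funext => i; have := hgr i; rewrite sat_fsubst E grP.
exists (codes z); rewrite sat_and sat_conj sat_fsubst; split=> // i.
by rewrite sat_fsubst E grP.
Qed.

End Coding.

Section Picture.
Variables (S : signature) (A : rstructure S) (L : language) (M : structure L).
Variables (s : lsort L) (g : univ A -> M s).

Lemma picture_sat (I : finType) (a b : I -> univ A)
    (p : formula (@const_ctx L I s)) :
  indiscernible_picture g -> same_atoms a b ->
  sat p (g \o a : env M (@const_ctx L I s)) ->
  sat p (g \o b : env M (@const_ctx L I s)).
Proof.
move=> [_ ind] ab ha; pose ev : 'I_#|I| -> I := enum_val.
pose p' := frename enum_rank p.
have E (c : I -> univ A) : (g \o (c \o ev)) \o enum_rank = g \o c :> (I -> M s).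
  by apply: funext => i /=; rewrite /ev enum_rankK.
have := ind _ (a \o ev) (b \o ev)
  ((qftp_same_atoms _ _).2 (same_atoms_comp ev ab)).
rewrite predeqE => /(_ p') [+ _].
by rewrite /tp /= !sat_frename !E; apply.
Qed.

Lemma picture_separates (I : finType) (a b : I -> univ A) :
  uncollapsed g -> ~ same_atoms a b ->
  exists p : formula (@const_ctx L I s),
    sat p (g \o a : env M (@const_ctx L I s)) /\
    ~ sat p (g \o b : env M (@const_ctx L I s)).
Proof.
move=> unc; apply: contra_notP => n; pose ev : 'I_#|I| -> I := enum_val.
have E (c : I -> univ A) : (g \o c) \o ev = g \o (c \o ev) :> (_ -> M s) by [].
have n' p : sat p (g \o a : env M (@const_ctx L I s)) ->
            sat p (g \o b : env M (@const_ctx L I s)).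
  by move=> h; apply: contrapT => h'; apply: n; exists p.
have ab : same_atoms (a \o ev) (b \o ev).
  apply/qftp_same_atoms/unc; rewrite predeqE => p; rewrite /tp /=.
  split=> h.
    by have := n' (frename ev p); rewrite !sat_frename; apply.
  apply: contrapT => h'.
  have := n' (f_not (frename ev p)).
  by rewrite !sat_not !sat_frename => /(_ h').
have := same_atoms_comp enum_rank ab.
suff EE (c : I -> univ A) : (c \o ev) \o enum_rank = c by rewrite !EE.
by apply: funext => i /=; rewrite /ev enum_rankK.
Qed.

(** There are finitely many diagrams of tuples indexed by [I], and one formula
    for each pair of them separates the corresponding types; the truth values of
    all these formulas determine the diagram. *)
Lemma picture_definable (I : finType) (Q : (I -> univ A) -> Prop) :
  indiscernible_picture g -> uncollapsed g ->
  (forall a b, same_atoms a b -> Q a -> Q b) ->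
  exists p : formula (@const_ctx L I s), forall a : I -> univ A,
    sat p (g \o a : env M (@const_ctx L I s)) <-> Q a.
Proof.
move=> ind unc inv.
pose D := {ffun atom S I -> bool}.
(* A formula that works for one pair of tuples with the given diagrams works for
   all of them, by indiscernibility. *)
have sep (d : D * D) : exists p : formula (@const_ctx L I s),
    forall a b : I -> univ A, diag a = d.1 -> diag b = d.2 -> d.1 <> d.2 ->
    sat p (g \o a : env M (@const_ctx L I s)) /\
    ~ sat p (g \o b : env M (@const_ctx L I s)).
  have [[a [b [ad bd dd]]]|n] := pselect (exists a b : I -> univ A,
      [/\ diag a = d.1, diag b = d.2 & d.1 <> d.2]); last first.
    by exists f_bot => a b ? ? ?; case: n; exists a, b.
  have nab : ~ same_atoms a b by rewrite -diagP ad bd.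
  have [p [pa pb]] := picture_separates unc nab.
  exists p => a' b' ad' bd' _; split.
    by apply: picture_sat pa => //; apply/diagP; rewrite ad.
  by move=> pb'; apply: pb; apply: picture_sat pb' => //; apply/diagP; rewrite bd.
have {sep}[F FP] := choice sep.
pose tv (a : I -> univ A) : {ffun D * D -> bool} :=
  [ffun x => `[< sat (F x) (g \o a : env M (@const_ctx L I s)) >]].
have [p hp] := definable_boolean F (fun v => exists b, Q b /\ v = tv b).
exists p => a; rewrite hp; split=> [[b [Qb e]]|Qa]; last by exists a.
apply: inv Qb; apply/diagP; apply: contrapT => n.
have [] := FP (diag b, diag a) b a erefl erefl n.
move: e => /ffunP/(_ (diag b, diag a)); rewrite !ffunE => e.
by move=> h1 h2; apply: h2; apply/asboolP; rewrite e; apply/asboolP.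
Qed.

Variables (s' : lsort L) (J : finType) (h : (J -> M s) -> M s').
Hypothesis hh : coding h.

(** Moving a private entry of the tuple of [b] changes neither the type of the
    whole family nor the codes of the other tuples. *)
Lemma picture_in_F (B : {fset nat}) (y : B * J -> univ A) :
  indiscernible_picture g -> mobile A ->
  (forall b, exists j, forall k, k != (b, j) -> y k <> y (b, j)) ->
  in_F (codes h (g \o y)).
Proof.
move=> ind mob priv; split=> [b b' /hh.1 e|B0 [_ B0p] [p [hp fin]]].
  have [j hj] := priv b; apply/eqP; rewrite eq_sym; apply/negP => /negP n.
  have := congr1 (fun f => f j) e => /= /ind.1 /esym; apply: hj.
  by apply: contra n => /eqP[->].
have [b nb] : exists b, ~ B0 b.
  by apply: contrapT => n; apply: B0p => b _; apply: contrapT => nb; apply: n; exists b.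
have [j hj] := priv b.
pose c : env M (@const_ctx L B0 s') := fun b => codes h (g \o y) (set_val b).
pose r v : term (@const_ctx L B s') (ctx_cat (@const_ctx L B s') (@const_ctx L B0 s') v) :=
  match v return term (@const_ctx L B s') (ctx_cat (@const_ctx L B s') (@const_ctx L B0 s') v)
  with
  | inl b => tvar (@const_ctx L B s') b
  | inr b => tvar (@const_ctx L B s') (set_val b : B)
  end.
have [q hq] := sat_codes_pullback hh (fsubst p r).
have E (z : univ A) : sat (fsubst p r) (codes h (g \o upd y (b, j) z) : env M (@const_ctx L B s'))
   <-> sat p (env_cat (codes h (g \o upd y (b, j) z) : env M (@const_ctx L B s')) c).
  rewrite sat_fsubst; suff -> : (fun v => eval (codes h (g \o upd y (b, j) z)
      : env M (@const_ctx L B s')) (r v)) =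
      env_cat (codes h (g \o upd y (b, j) z) : env M (@const_ctx L B s')) c by [].
  apply: functional_extensionality_dep => -[//|b0] /=.
  (* The parameters keep their codes, since [b] is not one of them. *)
  rewrite /c /codes; congr h; apply: funext => i /=; congr g; rewrite /upd.
  case: eqP => // -[eb _]; exfalso; apply: nb; rewrite -eb.
  exact: (set_mem (valP b0)).
have yE : upd y (b, j) (y (b, j)) = y.
  by apply: funext => k; rewrite /upd; case: eqP => // ->.
have hp' : sat q (g \o y : env M (@const_ctx L (B * J)%type s)).
  by rewrite hq -yE E yE.
(* If the type were algebraic, only finitely many moves of the private entry
   would preserve the diagram. *)
pose Z := [set z | same_atoms (upd y (b, j) z) y].
have finZ : finite_set Z.
  pose f z := codes h (g \o upd y (b, j) z) : env M (@const_ctx L B s').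
  have finj : injective f.
    move=> z z' /(congr1 (fun u => u b)) /hh.1 /(congr1 (fun u => u j)) /ind.1.
    by rewrite /upd eqxx.
  have := @finite_preimage _ _ _ f (in2W finj) fin.
  apply: sub_finite_set => z /= zZ; rewrite /f -E -hq.
  by apply: picture_sat hp' => //; apply: same_atoms_sym.
have [z [nz zZ]] := mob _ y (b, j) hj Z finZ.
exact: nz.
Qed.

(** The formulas only depend on the picture, on the coding and on [Q], whereas
    the structure [C] and the tuples [y] that describe it vary: this places a
    whole class of structures in a single age. *)
Lemma picture_age (T : theory L) (N : nat) (ar : 'I_N -> nat)
    (Q : forall i : 'I_N, ('I_(ar i) * J -> univ A) -> Prop) :
  models M T -> indiscernible_picture g -> uncollapsed g -> mobile A ->
  (forall i a b, same_atoms a b -> Q i a -> Q i b) ->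
  exists phi : formula_seq L ar, forall C : rstructure (seq_signature ar),
    finite_structure C ->
    forall y : univ C * J -> univ A,
      (forall c, exists j, forall k, k <> (c, j) -> y k <> y (c, j)) ->
      (forall (i : 'I_N) (c : 'I_(ar i) -> univ C),
         @rrel _ C i c <-> Q i (fun kj => y (c kj.1, kj.2))) ->
      Age T phi C.
Proof.
move=> MT ind unc mob inv.
have phi_ex i : exists q : formula (@const_ctx L 'I_(ar i) s'),
    forall a : 'I_(ar i) * J -> univ A,
      sat q (codes h (g \o a) : env M (@const_ctx L 'I_(ar i) s')) <-> Q i a.
  have [p hp] := picture_definable ind unc (inv i).
  have [q hq] := sat_codes hh p.
  by exists q => a; rewrite hq hp.
pose phi i := sval (cid (phi_ex i)).
exists (FormulaSeq phi) => C fin y priv rel.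
have [B [e [e' [eK e'K]]]] := finite_fset_bij fin.
pose y' (bj : B * J) := y (e' bj.1, bj.2).
exists M, B, (codes h (g \o y')); split=> //.
  apply: picture_in_F => // b; have [j hj] := priv (e' b).
  exists j => -[b1 j1] /eqP n; apply: hj => /= -[eb ej]; apply: n.
  by rewrite -(e'K b1) eb e'K ej.
exists e; split; last by exists e'.
split=> [|i c]; first exact: can_inj eK.
rewrite rel -(svalP (cid (phi_ex i))) /rrel /=.
suff -> : codes h (g \o y') \o (e \o c) = codes h (g \o fun kj => y (c kj.1, kj.2)).
  by [].
by apply: funext => k; rewrite /codes /y' /=; congr h; apply: funext => l /=; rewrite eK.
Qed.

End Picture.

(** * Mobility of the generic models *)

Definition atom_formula (S : signature) (I : finType) (x : atom S I) :
    formula (@const_ctx (rlang S) I tt) :=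
  match x with
  | inl ij => f_eq (tvar (@const_ctx (rlang S) I tt) ij.1)
                   (tvar (@const_ctx (rlang S) I tt) ij.2)
  | inr rc => @f_rel (rlang S) _ _ (tag rc)
      (fun k => tvar (@const_ctx (rlang S) I tt) (tagged rc k))
  end.

Lemma same_atoms_formula (S : signature) (A B : rstructure S) (I : finType)
    (y : I -> univ B) :
  exists p : formula (@const_ctx (rlang S) I tt), forall a : I -> univ A,
    sat p (a : env A (@const_ctx (rlang S) I tt)) <-> same_atoms a y.
Proof.
have [p hp] := definable_boolean (@atom_formula S I) (fun v => v = diag y).
exists p => a; rewrite hp -diagP.
suff -> : diag a = [ffun x => `[< sat (atom_formula x)
  (a : env A (@const_ctx (rlang S) I tt)) >]] by [].
by apply/ffunP => -[[i j]|[r c]]; rewrite !ffunE.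
Qed.

Lemma models_Th (L : language) (M : structure L) :
  (forall s, inhabited (M s)) -> models M (Th M).
Proof. by []. Qed.

(** If an entry could only be moved inside a finite set, then its diagram over
    the other entries would be an algebraic formula. *)
Lemma trivial_mobile (S : signature) (A : rstructure S) :
  algebraically_trivial (Th A) -> mobile A.
Proof.
move=> triv I y i priv F finF; apply: contrapT => n.
have {}n z : same_atoms (upd y i z) y -> F z.
  by move=> h; apply: contrapT => nz; apply: n; exists z.
pose X := [set x | exists2 j, j != i & y j = x].
have At : models A (Th A) by apply: models_Th => -[]; constructor; exact: (y i).
suff : X (y i) by move=> [j /priv].
rewrite -(triv A At X).
pose I' : finType := {j : I | j != i}.
pose c (k : 'I_#|{: I'}|) : univ A := y (val (enum_val k : I')).
exists #|{: I'}|, c; split.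
  by move=> k; exists (val (enum_val k : I')) => //; apply: (valP (enum_val k)).
have [p hp] := same_atoms_formula A y.
pose G := ctx_cat (@const_ctx (rlang S) 'I_1 tt) (@const_ctx (rlang S) 'I_#|{: I'}| tt).
pose r (v : I) : term G tt := match insub v : option I' with
   | Some v' => tvar G (inr (enum_rank v'))
   | None => tvar G (inl ord0) end.
exists (fsubst p r).
have E (a : env A (@const_ctx (rlang S) 'I_1 tt)) :
   (fun v => eval (env_cat a (c : env A (@const_ctx (rlang S) 'I_#|{: I'}| tt))) (r v))
   = upd y i (a ord0).
  apply: funext => v; rewrite /r /upd; case: insubP => [v' nv ev|].
    by rewrite /= /c enum_rankK ev (negbTE nv).
  by rewrite negbK => ->.
split.
  rewrite sat_fsubst E hp.
  suff -> : upd y i (y i) = y by [].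
  by apply: funext => j; rewrite /upd; case: eqP => // ->.
apply: (@sub_finite_set _ _ ((fun z (_ : 'I_1) => z) @` F)); last exact: finite_image.
move=> a /=; rewrite sat_fsubst E hp => /n Fa; exists (a ord0) => //.
by apply: funext => k; rewrite ord1.
Qed.

(** ** Order expansions *)

Section OrderExpansion.
Variable S : signature.

Lemma rrel_order (B : rstructure (order_signature S)) (c : 'I_2 -> univ B) :
  @rrel (order_signature S) B None c <-> lt_rel (c ord0) (c ord_max).
Proof.
rewrite /lt_rel; suff <- : c = (fun i : 'I_2 => if i == ord0 then c ord0 else c ord_max).
  by [].
apply: funext => i; case: eqP => [->//|/eqP]; case: i => -[|[|]]//= hi _.
by congr c; apply: val_inj.
Qed.

Lemma same_atoms_order (B B' : rstructure (order_signature S)) (V : Type)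
    (a : V -> univ B) (b : V -> univ B') :
  same_atoms a b <->
  @same_atoms S (reduct B) (reduct B') V a b /\
  forall v w, lt_rel (a v) (a w) <-> lt_rel (b v) (b w).
Proof.
split=> [[h1 h2]|[[h1 h2] h3]].
  split=> [|v w]; first by split=> // r c; apply: (h2 (Some r)).
  have := h2 None (fun i : 'I_2 => if i == ord0 then v else w).
  by rewrite !rrel_order.
split=> // -[r|] c; first exact: h2.
by rewrite !rrel_order; apply: h3.
Qed.

Definition order_pull (A : rstructure S) (X : Type) (d : X -> univ A)
    (lt : X -> X -> Prop) : rstructure (order_signature S) :=
  @mk_rstructure (order_signature S) X (fun r =>
    match r return ('I_(@arity (order_signature S) r) -> X) -> Prop with
    | Some r => fun c => @rrel S A r (d \o c)
    | None => fun c => lt (c ord0) (c ord_max)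
    end).

Lemma lt_order_pull (A : rstructure S) (X : Type) (d : X -> univ A)
    (lt : X -> X -> Prop) (x y : X) :
  @lt_rel S (order_pull d lt) x y <-> lt x y.
Proof. by []. Qed.

Lemma reduct_order_pull (A : rstructure S) (X : Type) (d : X -> univ A)
    (lt : X -> X -> Prop) (V : Type) (a : V -> X) : injective d ->
  @same_atoms S (reduct (order_pull d lt)) A V a (d \o a).
Proof. by move=> dinj; split=> // v w; split=> [/(congr1 d)|/dinj]. Qed.

Lemma order_pull_class (K : rstructure S -> Prop) (A : rstructure S) (X : Type)
    (d : X -> univ A) (lt : X -> X -> Prop) :
  generic_model K A -> finite_set [set: X] -> injective d ->
  strict_linear_order lt -> order_class K (order_pull d lt).
Proof.
move=> [_ Kgen _] fin dinj lin; split=> //.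
apply/Kgen; split=> //; constructor; exists d; split=> //.
Qed.

Lemma generic_embedding (K : rstructure S -> Prop) (A : rstructure S)
    (B : rstructure S) : generic_model K A -> K B ->
  exists e : univ B -> univ A, is_embedding e.
Proof. by move=> [_ Kgen _] /Kgen[_ [[e he]]]; exists e. Qed.

End OrderExpansion.

Section GenericModels.
Variables (S : signature) (K : rstructure S -> Prop).
Variables (A : rstructure S) (Alt : rstructure (order_signature S)).
Hypotheses (genA : generic_model K A) (genAlt : generic_model (order_class K) Alt).

Lemma generic_pull (X : Type) (w : X -> univ Alt) :
  finite_set [set: X] -> injective w ->
  K (@mk_rstructure S X (fun r c => @rrel _ (reduct Alt) r (w \o c))) /\
  strict_linear_order (fun x y => lt_rel (w x) (w y)).
Proof.
move=> fin winj.
pose P := @mk_rstructure (order_signature S) X (fun r c => rrel (w \o c)).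
have [_ Kgen _] := genAlt.
have [//|_ KP lin] := (Kgen P).2; first by split=> //; constructor; exists w.
split=> //; suff <- : @lt_rel S P = (fun x y => lt_rel (w x) (w y)) by [].
apply: funext => x; apply: funext => y; apply: propext.
by rewrite /lt_rel /rrel /=; rewrite [X in X <-> _]rrel_order.
Qed.

(** The moving point is found in the unordered generic model, and it can be
    inserted in the linear order next to the point that it replaces: in the
    structure built on [option J], the new element [None] is a twin of [j0] in
    the reduct and comes immediately after it in the order. *)
Lemma mobile_order : mobile A -> mobile Alt.
Proof.
move=> mob I y i priv F finF.
have finW : finite_set (F `|` range y).
  by rewrite finite_setU; split=> //; apply: finite_image.
have [J [w [winj wE]]] := finite_set_tuple finW.
have /choice[t tE] : forall k, exists j, w j = y k.
  by move=> k; apply/wE; right; exists k.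
pose j0 := t i.
have tpriv k : k != i -> t k != j0.
  by move=> ki; apply/eqP => e; apply: (priv k ki); rewrite -!tE e.
have [KJ [irr trans tot]] := generic_pull (@finite_finset _ _) winj.
have [e [einj eE]] := generic_embedding genA KJ.
have [z' [nz' hz']] : exists z', ~ range e z' /\ same_atoms (upd e j0 z') e.
  apply: mob; last by apply: finite_image; apply: finite_finset.
  by move=> j n /einj ej; rewrite ej eqxx in n.
pose d (o : option J) : univ A := if o is Some j then e j else z'.
have dinj : injective d.
  move=> [j|] [k|] //=; first by move=> /einj ->.
    by move=> ez; case: nz'; exists j.
  by move=> ez; case: nz'; exists k.
pose pi (o : option J) := if o is Some j then j else j0.
pose lt (o o' : option J) := lt_rel (w (pi o)) (w (pi o')) \/
  o = Some j0 /\ o' = None.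
have lin : strict_linear_order lt.
  split.
  - by move=> o [/irr//|[-> //]].
  - move=> o1 o2 o3 [h12|[e1 e2]] [h23|[e3 e4]]; subst => //.
    + by left; apply: trans h23.
    + by left.
    + by left.
  - move=> o o'; have [h|h|h] := tot (pi o) (pi o').
    + by apply: Or31; left.
    + case: o o' h => [j|] [k|] /= h; try subst.
      * by apply: Or32; congr Some.
      * by apply: Or31; right.
      * by apply: Or33; right.
      * by apply: Or32.
    + by apply: Or33; left.
have KD := order_pull_class genA (@finite_finset _ _) dinj lin.
have [v vemb] := generic_embedding genAlt KD.
(* Ultrahomogeneity brings the copy of the old points back to their place, and
   the new point with them. *)
have vSome : same_atoms (v \o Some) w.
  apply: same_atoms_trans (same_atoms_sym (same_atoms_embedding _ vemb)) _.
  apply/same_atoms_order; split.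
    apply: same_atoms_trans (reduct_order_pull _ _ dinj) _.
    by split=> [j k|r c]; [split=> [/einj|/winj] ->|rewrite -eE].
  move=> j k; rewrite lt_order_pull /lt /=; split; last by left.
  by case=> // -[_ []].
have [_ _ hom] := genAlt.
have [g [[[ginj gemb] gbij] gE]] := ultrahomogeneous_tuple hom vSome.
pose t' k := if k == i then None else Some (t k).
have updE : upd y i (g (v None)) = g \o (v \o t').
  apply: funext => k; rewrite /upd /t' /=; case: eqP => // _.
  by rewrite -[v (Some _)]/((v \o Some) _) gE tE.
exists (g (v None)); split.
  move=> Fz; have /wE[j] : (F `|` range y) (g (v None)) by left.
  by rewrite -gE => /ginj /vemb.1.
rewrite updE.
apply: same_atoms_trans (same_atoms_sym (same_atoms_embedding _ (conj ginj gemb))) _.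
apply: same_atoms_trans (same_atoms_sym (same_atoms_embedding _ vemb)) _.
have -> : y = w \o t by apply: funext => k /=; rewrite tE.
apply/same_atoms_order; split.
  apply: same_atoms_trans (reduct_order_pull _ _ dinj) _.
  have -> : d \o t' = upd e j0 z' \o t.
    apply: funext => k; rewrite /t' /upd /=; case: eqP => [->|/eqP/tpriv/negbTE->] //.
    by rewrite eqxx.
  apply: same_atoms_trans (same_atoms_comp t hz') _.
  by split=> [j k|r c]; [split=> [/einj|/winj] /= ->|rewrite -eE].
have pit k : pi (t' k) = t k by rewrite /t'; case: eqP => [->|].
move=> k l; rewrite lt_order_pull /lt !pit; split; last by left.
case=> // -[]; rewrite /t'; case: eqP => // /eqP/tpriv n [e0].
by rewrite e0 eqxx in n.
Qed.

End GenericModels.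

(** * Imaginaries *)

(** Elimination of the imaginary sorts in favour of representatives: a variable
    of an imaginary sort is replaced by a tuple of variables. *)
Section Representatives.
Variables (L : language) (T : theory L).
Local Notation Leq := (eq_language T).

Definition rep_size (s : lsort Leq) : nat :=
  match s with inl _ => 1 | inr E => im_n E end.

Definition rep_ctx (s : lsort Leq) : 'I_(rep_size s) -> lsort L :=
  match s return 'I_(rep_size s) -> lsort L with
  | inl u => fun _ => u
  | inr E => @im_ctx _ _ E
  end.

Definition rep_class (M : structure L) (s : lsort Leq) :
    env M (@rep_ctx s) -> eq_structure T M s :=
  match s return env M (@rep_ctx s) -> eq_structure T M s with
  | inl u => fun a => a ord0
  | inr E => fun a => exist _ (im_class a) (ex_intro _ a erefl)
  end.

Lemma rep_class_surj (M : structure L) (s : lsort Leq) (x : eq_structure T M s) :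
  exists a : env M (@rep_ctx s), x = rep_class a.
Proof.
case: s x => [u|E] x; first by exists (fun _ => x).
by case: x => X [a e]; exists a; apply: eq_exist.
Qed.

Definition rep_var (V : Type) (G : V -> lsort Leq) : Type :=
  {v : V & 'I_(rep_size (G v))}.

Definition rep_env_ctx (V : Type) (G : V -> lsort Leq) (w : rep_var G) : lsort L :=
  rep_ctx (projT2 w).

Definition rep_env (M : structure L) (V : Type) (G : V -> lsort Leq)
    (a : env M (@rep_env_ctx V G)) : env (eq_structure T M) G :=
  fun v => rep_class (fun i => a (existT _ v i)).

Fixpoint rep_term (V : Type) (G : V -> lsort Leq) (s : lsort Leq) (t : term G s) :
    forall i : 'I_(rep_size s), term (@rep_env_ctx V G) (rep_ctx i) :=
  match t in term _ s
    return forall i : 'I_(rep_size s), term (@rep_env_ctx V G) (rep_ctx i) with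
  | tvar v => fun i => tvar (@rep_env_ctx V G) (existT _ v i)
  | tapp f args =>
      match f return
        (forall k (i : 'I_(rep_size (@fdom Leq f k))),
           term (@rep_env_ctx V G) (rep_ctx i)) ->
        forall i : 'I_(rep_size (@fcod Leq f)),
          term (@rep_env_ctx V G) (rep_ctx i) with
      | inl f => fun r i => @tapp L _ (@rep_env_ctx V G) f (fun k => r k ord0)
      | inr E => fun r i => r i ord0
      end (fun k => rep_term (args k))
  end.

Lemma eval_rep_term (M : structure L) (V : Type) (G : V -> lsort Leq)
    (s : lsort Leq) (t : term G s) (a : env M (@rep_env_ctx V G)) :
  eval (rep_env a) t = rep_class (fun i => eval a (rep_term t i)).
Proof.
elim: t => // f args IH.
have e : (fun k => eval (rep_env a) (args k)) =
         (fun k => rep_class (fun i => eval a (rep_term (args k) i))).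
  exact: functional_extensionality_dep.
by rewrite /= e; case: f args IH e.
Qed.

Definition rep_eq (W : Type) (H : W -> lsort L) (s : lsort Leq) :
    (forall i : 'I_(rep_size s), term H (rep_ctx i)) ->
    (forall i : 'I_(rep_size s), term H (rep_ctx i)) -> formula H :=
  match s return
    (forall i : 'I_(rep_size s), term H (rep_ctx i)) ->
    (forall i : 'I_(rep_size s), term H (rep_ctx i)) -> formula H with
  | inl u => fun t t' => f_eq (t ord0) (t' ord0)
  | inr E => fun t t' => fsubst (im_rel E)
      (fun v => match v return term H (ctx_cat (@im_ctx _ _ E) (@im_ctx _ _ E) v)
                with inl i => t i | inr i => t' i end)
  end.

(** Two representatives are compared by the equivalence relation of their sort,
    which is an equivalence in the models of [T] only. *)
Lemma sat_rep_eq (M : structure L) (W : Type) (H : W -> lsort L) (s : lsort Leq)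
    (t t' : forall i : 'I_(rep_size s), term H (rep_ctx i)) (a : env M H) :
  models M T ->
  sat (rep_eq t t') a <->
  rep_class (fun i => eval a (t i)) = rep_class (fun i => eval a (t' i)).
Proof.
move=> MT; case: s t t' => [u|E] t t' //=.
rewrite sat_fsubst.
have [refl sym trans] := im_equiv E MT.
set b := (fun i => eval a (t i)) : env M (@im_ctx _ _ E).
set b' := (fun i => eval a (t' i)) : env M (@im_ctx _ _ E).
have -> : (fun v => eval a (match v return
    term H (ctx_cat (@im_ctx _ _ E) (@im_ctx _ _ E) v)
    with inl i => t i | inr i => t' i end)) = env_cat b b'.
  by apply: functional_extensionality_dep => -[].
split=> [h|[e]]; last first.
  by have := refl b'; rewrite -[sat _ _]/(im_class b' b') -e.
apply: eq_exist; rewrite predeqE => c; split; first exact/trans/sym.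
exact: trans.
Qed.

(** A quantifier over an imaginary sort becomes a block of quantifiers over
    representatives. *)
Lemma rep_formula (V : Type) (G : V -> lsort Leq) (p : formula G) :
  exists q : formula (@rep_env_ctx V G), forall M : structure L, models M T ->
    forall a : env M (@rep_env_ctx V G), sat p (rep_env a) <-> sat q a.
Proof.
elim: p => {V G} [V G s t u|V G r args|V G|V G p [p' hp] q [q' hq]|V G s p [p' hp]].
- exists (rep_eq (rep_term t) (rep_term u)) => M MT a.
  by rewrite sat_rep_eq// /= !eval_rep_term.
- exists (@f_rel L _ _ r (fun k => rep_term (args k) ord0)) => M MT a /=.
  suff -> : (fun k => eval (rep_env a) (args k)) =
            (fun k => eval a (rep_term (args k) ord0)) by [].
  by apply: functional_extensionality_dep => k; rewrite eval_rep_term.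
- by exists f_bot.
- exists (f_imp p' q') => M MT a.
  by split=> h /(hp _ MT)/h/(hq _ MT).
- pose H := ctx_cat (@rep_env_ctx V G) (@rep_ctx s).
  pose r (w : rep_var (ctx_cons s G)) : term H (rep_env_ctx w) :=
    match w return term H (rep_env_ctx w) with
    | existT (Some v) i => tvar H (inl (existT _ v i))
    | existT None i => tvar H (inr i)
    end.
  have [q hq] := ex_block (f_not (fsubst p' r)).
  exists (f_not q) => M MT a.
  have E (b : env M (@rep_ctx s)) :
      sat (fsubst p' r) (env_cat a b) <-> sat p (env_cons (rep_class b) (rep_env a)).
    rewrite sat_fsubst -hp//.
    have -> : rep_env (fun w => eval (env_cat a b) (r w)) =
              env_cons (rep_class b) (rep_env a).
      by apply: functional_extensionality_dep => -[v|].
    by [].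
  rewrite sat_not hq; split=> [h [b]|h c]; first by rewrite sat_not E; apply; apply: h.
  have [b ->] := rep_class_surj c; apply/E; apply: contrapT => n; apply: h.
  by exists b.
Qed.

End Representatives.

(** The existence of a configuration with finitely many variables is a
    sentence. *)
Lemma Th_exists (L : language) (A M : structure L) (W : finType)
    (H : W -> lsort L) (p : formula H) :
  models M (Th A) -> (exists a : env M H, sat p a) -> exists a : env A H, sat p a.
Proof.
move=> [_ MA]; have [q hq] := ex_closure p => /hq hM; apply/hq.
by apply: contrapT => n; apply: (MA (f_not q)) hM.
Qed.

(** The sentence expresses a property of imaginaries; it is decided in the same
    way in all the models of [Th A], because it translates into a sentence about
    representatives. *)
Lemma eq_theory_exists (L : language) (A : structure L)
    (M : structure (eq_language (Th A))) (W : finType)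
    (H : W -> lsort (eq_language (Th A))) (p : formula H) :
  models A (Th A) -> models M (eq_theory (Th A)) ->
  (exists a : env M H, sat p a) ->
  exists a : env (eq_structure (Th A) A) H, sat p a.
Proof.
move=> AA [_ MA]; have [q hq] := ex_closure p => /hq hM; apply/hq.
apply: contrapT => n; apply: (MA (f_not q)) hM => N NA; rewrite /holds sat_not.
have [q' hq'] := rep_formula q.
pose r (w : rep_var (@ctx_nil (lsort (eq_language (Th A))))) :
  term (@ctx_nil (lsort L)) (rep_env_ctx w) := match projT1 w with end.
have E (B : structure L) : models B (Th A) ->
    holds (eq_structure (Th A) B) q <-> holds B (fsubst q' r).
  move=> BA; rewrite /holds sat_fsubst -hq'//.
  suff -> : rep_env (fun w => eval (env_nil B) (r w)) = env_nil (eq_structure (Th A) B).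
    by [].
  by apply: functional_extensionality_dep => -[].
move/(E _ NA); apply: (NA.2 (f_not (fsubst q' r))).
by rewrite /Th /= => /(E _ AA).
Qed.

Section GenericImaginaries.
Variables (S : signature) (A : rstructure S).
Hypothesis homA : ultrahomogeneous A.
Local Notation Leq := (eq_language (Th A)).
Local Notation Aeq := (eq_structure (Th A) A).

Definition rep_tuple (V : Type) (G : V -> lsort Leq) (a : rep_var G -> univ A) :
    env Aeq G :=
  rep_env (uenv (@rep_env_ctx _ _ V G) a).

Lemma rep_tuple_surj (V : Type) (G : V -> lsort Leq) (e : env Aeq G) :
  exists a : rep_var G -> univ A, e = rep_tuple a.
Proof.
have wit v : {b : env A (@rep_ctx _ _ (G v)) | e v = rep_class b}.
  by apply: cid; apply: rep_class_surj.
have [a ha] := @uenv_surj S A _ (@rep_env_ctx _ _ V G)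
  (fun w => sval (wit (projT1 w)) (projT2 w)).
exists a; apply: functional_extensionality_dep => v.
by rewrite /rep_tuple -ha (svalP (wit v)).
Qed.

(** Automorphisms preserve formulas about imaginaries, by translation into
    formulas about representatives. *)
Lemma sat_rep_tuple (V : finType) (G : V -> lsort Leq) (p : formula G)
    (a b : {v : V & 'I_(rep_size (G v))} -> univ A) :
  models A (Th A) -> same_atoms a b ->
  sat p (rep_tuple a) -> sat p (rep_tuple b).
Proof.
move=> AA /(ultrahomogeneous_tuple homA)[g [iso gE]].
have [q hq] := rep_formula p.
rewrite /rep_tuple !hq// (sat_isomorphism _ _ iso).
by congr sat; congr uenv; apply: funext.
Qed.

(** Through this picture the general construction of ages also applies to the
    theory of the generic model. *)
Definition eq_picture : univ A -> Aeq (inl tt) := id.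

Lemma eq_picture_indiscernible :
  models A (Th A) -> indiscernible_picture eq_picture.
Proof.
move=> AA; split=> // n a b /qftp_same_atoms ab.
pose G := @const_ctx Leq 'I_n (inl tt).
pose ext (c : 'I_n -> univ A) (w : {v : 'I_n & 'I_(rep_size (G v))}) := c (tag w).
have imp c d p : same_atoms c d -> sat p (c : env Aeq G) -> sat p (d : env Aeq G).
  move=> cd; have := @sat_rep_tuple 'I_n G p (ext c) (ext d) AA.
  by apply; apply: (same_atoms_comp (@tag _ _) cd).
rewrite predeqE => p; split; apply: imp => //.
exact: same_atoms_sym.
Qed.

Lemma eq_picture_uncollapsed : uncollapsed eq_picture.
Proof.
move=> n a b e; apply/qftp_same_atoms.
pose G := @const_ctx Leq 'I_n (inl tt).
have {}e p : sat p (a : env Aeq G) <-> sat p (b : env Aeq G).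
  move: e; rewrite predeqE => /(_ p) [h1 h2].
  by split; [exact: h1|exact: h2].
split=> [v w|r c]; first exact: (e (f_eq (tvar G v) (tvar G w))).
exact: (e (@f_rel Leq _ _ r (fun k => tvar G (c k)))).
Qed.

(** The code of a tuple is its class in the imaginary sort that belongs to the
    equality of tuples. *)
Lemma eq_coding (J : finType) :
  exists (s : lsort Leq) (h : (J -> Aeq (inl tt)) -> Aeq s), coding h.
Proof.
pose G := @const_ctx (rlang S) 'I_#|J| tt.
pose im := ImaginarySort (@tuple_eq_equivalence _ (Th A) _ G).
pose ev : 'I_#|J| -> J := enum_val.
exists (inr im), (fun z => @finterp Leq Aeq (inr im) (fun i => z (ev i))); split.
  move=> z z' [/= e]; apply: funext => j.
  have : @im_class _ _ A im (fun i => z' (ev i)) (fun i => z' (ev i)).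
    exact/sat_tuple_eq.
  rewrite -e => /sat_tuple_eq /(congr1 (fun f => f (enum_rank j))).
  by rewrite /ev enum_rankK.
pose H := ctx_cons (inr im : lsort Leq) (@const_ctx Leq J (inl tt)).
by exists (f_eq (@tapp Leq _ H (inr im) (fun i => tvar H (Some (ev i)))) (tvar H None)).
Qed.

End GenericImaginaries.

(** * Ordered structures in an age of the expansion by imaginaries *)

(** The entries are moved off [F] one after the other. *)
Lemma mobile_avoid (S : signature) (A : rstructure S) (I : finType)
    (e : I -> univ A) (F : set (univ A)) :
  mobile A -> injective e -> finite_set F ->
  exists e' : I -> univ A, same_atoms e' e /\ forall i, ~ F (e' i).
Proof.
move=> mob einj finF.
suff [e' [h1 h2]] : exists e' : I -> univ A,
    same_atoms e' e /\ forall i, i \in enum I -> ~ F (e' i).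
  by exists e'; split=> // i; apply: h2; rewrite mem_enum.
elim: (enum I) => [|i s [e' [h1 h2]]]; first by exists e.
have [j n|z [nz hz]] := mob I e' i _ F finF.
  by move=> /(h1.1 _ _)/einj ji; rewrite ji eqxx in n.
exists (upd e' i z); split; first exact: same_atoms_trans h1.
by move=> j; rewrite inE /upd; case: eqP => //= _ /h2.
Qed.

Lemma rank_order (B : finType) (lt : B -> B -> Prop) :
  strict_linear_order lt ->
  exists r : B -> 'I_#|B|, forall x y, lt x y <-> (r x < r y)%N.
Proof.
move=> [irr trans tot].
pose D x : {pred B} := [pred z | `[< lt z x >]].
have inD x z : z \in D x <-> lt z x by split=> /asboolP.
have Dlt x y : lt x y -> (#|D x| < #|D y|)%N.
  move=> xy; apply: proper_card; apply/fintype.properP; split.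
    by apply/fintype.subsetP => z /inD zx; apply/inD/(trans _ _ _ zx xy).
  by exists x; [apply/inD|apply/negP => /inD/irr].
have DB x : (#|D x| < #|B|)%N.
  apply: proper_card; apply/fintype.properP; split; first by apply/fintype.subsetP.
  by exists x => //; apply/negP => /inD/irr.
exists (fun x => Ordinal (DB x)) => x y /=; split; first exact: Dlt.
have [//|->|/Dlt h1 h2] := tot x y; first by rewrite ltnn.
by have := ltn_trans h1 h2; rewrite ltnn.
Qed.

Definition pair_tuple (X J : Type) (t u : J -> X) (v : J + J) : X :=
  match v with inl j => t j | inr j => u j end.

Section OrderTuples.
Variables (S : signature) (A : rstructure S).
Hypothesis homA : ultrahomogeneous A.

(** The order property is transferred to the generic model in its finite
    instances. The two halves of its formula are put together in one tuple, so
    that a single sequence of tuples is ordered by an invariant relation. *)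
Lemma order_tuples :
  unstable (Th A) ->
  exists (J : finType) (R : (J -> univ A) -> (J -> univ A) -> Prop),
    (forall t t' u u', same_atoms (pair_tuple t t') (pair_tuple u u') ->
       R t t' -> R u u') /\
    (forall N, exists c : 'I_N -> J -> univ A,
       forall i j, R (c i) (c j) <-> (i < j)%N).
Proof.
move=> [m [n [G [H [p [M [MA [a [b ab]]]]]]]]].
pose J : finType := ('I_m + 'I_n)%type.
pose half (t u : J -> univ A) (v : J) : univ A :=
  match v with inl _ => t v | inr _ => u v end.
exists J, (fun t u => sat p (uenv (ctx_cat G H) (half t u))); split.
  move=> t t' u u' /(ultrahomogeneous_tuple homA)[g [iso gE]].
  rewrite (sat_isomorphism _ _ iso).
  suff -> : g \o half t t' = half u u' by [].
  by apply: funext => -[i|i]; [exact: (gE (inl (inl i)))|exact: (gE (inr (inr i)))].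
move=> N.
pose GH := ctx_cat G H.
pose W : finType := ('I_N * J)%type.
pose Hc (w : W) := GH w.2.
pose r (ij : 'I_N * 'I_N) (v : J) : term Hc (GH v) :=
  match v return term Hc (GH v) with
  | inl k => tvar Hc (ij.1, inl k)
  | inr k => tvar Hc (ij.2, inr k)
  end.
pose q : formula Hc := f_conj (fun ij : 'I_N * 'I_N =>
  if (ij.1 < ij.2)%N then fsubst p (r ij) else f_not (fsubst p (r ij))).
have [|e] := @Th_exists _ A M W Hc q MA.
  exists (fun w : W => match w return M (Hc w) with
    | (i, inl k) => a i k
    | (i, inr k) => b i k
    end).
  rewrite sat_conj => -[i j] /=.
  set e := (fun w : W => _).
  have E : sat (fsubst p (r (i, j))) e <-> (i < j)%N.
    rewrite sat_fsubst -ab.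
    suff -> : (fun v => eval e (r (i, j) v)) = env_cat (a i) (b j) by [].
    by apply: functional_extensionality_dep => -[].
  by case: ifP => h; rewrite ?sat_not E // h.
have [x ->] := uenv_surj e.
rewrite sat_conj => hx.
exists (fun i j => x (i, j)) => i j; have := hx (i, j).
have -> : uenv GH (half (fun k => x (i, k)) (fun k => x (j, k))) =
          (fun v => eval (uenv Hc x) (r (i, j) v)).
  by apply: functional_extensionality_dep => -[].
by rewrite /=; case: ifP => h; rewrite ?sat_not sat_fsubst; split.
Qed.

End OrderTuples.

Section OrderSequence.
Variable S : signature.

(** Ages are defined for sequences of formulas, so the symbols of the expanded
    signature have to be numbered. *)
Definition order_arity (i : 'I_#|{: option (symb S)}|) : nat :=
  @arity (order_signature S) (enum_val i).

Definition order_seq_structure (B : rstructure (order_signature S)) :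
    rstructure (seq_signature order_arity) :=
  @mk_rstructure (seq_signature order_arity) (univ B)
    (fun i c => @rrel (order_signature S) B (enum_val i) c).

Variables (K : rstructure S -> Prop) (A : rstructure S).
Hypothesis genA : generic_model K A.

(** An element of an ordered structure [C] is described by the entry [None], its
    image in a copy of the reduct of [C], and by the entries [Some j], the tuple
    of the order property that has the rank of the element in [C] as index. The
    copy of the reduct is chosen disjoint from these tuples, which makes the
    entries at [None] private. *)
Lemma order_class_age :
  models A (Th A) -> mobile A -> unstable (Th A) ->
  exists phi : formula_seq (eq_language (Th A)) order_arity,
    forall C, order_class K C ->
      Age (eq_theory (Th A)) phi (order_seq_structure C).
Proof.
move=> AA mob unst; have [_ _ homA] := genA.
have [J [R [Rinv Rord]]] := order_tuples homA unst.
have Meq : models (eq_structure (Th A) A) (eq_theory (Th A)).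
  split; last by move=> p /(_ A AA).
  have x : univ A by have [/(_ tt)/inhabited_witness] := AA.
  by move=> s; constructor; apply: rep_class => i; apply: to_sort.
have [s [h hh]] := eq_coding A (option J).
pose Q (r : option (symb S)) :
    ('I_(@arity (order_signature S) r) * option J -> univ A) -> Prop :=
  match r return ('I_(@arity (order_signature S) r) * option J -> univ A) -> Prop with
  | Some r => fun a => @rrel S A r (fun k => a (k, None))
  | None => fun a => R (fun j => a (ord0, Some j)) (fun j => a (ord_max, Some j))
  end.
have Qinv r a b : same_atoms a b -> Q r a -> Q r b.
  case: r a b => [r|] a b ab /=; first by move/(ab.2 r (fun k => (k, None))).
  apply: Rinv.
  pose f (v : J + J) : 'I_2 * option J :=
    match v with inl j => (ord0, Some j) | inr j => (ord_max, Some j) end.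
  have E c : pair_tuple (fun j => c (ord0, Some j)) (fun j => c (ord_max, Some j))
      = c \o f :> (J + J -> univ A) by apply: funext => -[].
  by rewrite !E; apply: same_atoms_comp.
have [phi hphi] := @picture_age S A (eq_language (Th A)) _
  (inl tt) (@eq_picture S A) s _ h hh
  _ _ order_arity (fun i => Q (enum_val i)) Meq
  (eq_picture_indiscernible homA AA) (@eq_picture_uncollapsed S A) mob
  (fun i => Qinv (enum_val i)).
exists phi => C [fin KC lin].
have [B [w' [w [wK w'K]]]] := finite_fset_bij fin.
have [e emb] := generic_embedding genA KC.
have linB : strict_linear_order (fun b b' : B => lt_rel (w b) (w b')).
  case: lin => irr trans tot; split=> [b|b1 b2 b3|b b'].
  - exact: irr.
  - exact: trans.
  - have [l|/(congr1 w')|l] := tot (w b) (w b').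
    + exact: Or31.
    + by rewrite !w'K => ->; apply: Or32.
    + exact: Or33.
have [rk rkE] := rank_order linB.
have [c cE] := Rord #|{: B}|.
have finF : finite_set (range (fun ij : 'I_#|{: B}| * J => c ij.1 ij.2)).
  by apply: finite_image; apply: finite_finset.
have ewinj : injective (fun b => e (w b)) by move=> b b' /emb.1 /(can_inj w'K).
have [e' [e'e e'F]] := mobile_avoid mob ewinj finF.
pose y (k : univ C * option J) : univ A :=
  match k.2 with None => e' (w' k.1) | Some j => c (rk (w' k.1)) j end.
apply: (hphi (order_seq_structure C) fin y).
  move=> x; exists None => -[x' [j|]] n; rewrite /y /=.
    by move=> ec; apply: (e'F (w' x)); exists (rk (w' x'), j).
  move/(e'e.1 _ _)/ewinj/(can_inj wK) => xx; apply: n; by rewrite xx.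
suff rel (r : option (symb S)) (x : 'I_(@arity (order_signature S) r) -> univ C) :
    @rrel (order_signature S) C r x <-> Q r (fun kj => y (x kj.1, kj.2)).
  by move=> i x; apply: (rel (enum_val i) x).
case: r x => [r|] x; last by rewrite rrel_order /= /y /= cE -rkE !wK.
have h1 := (@same_atoms_embedding S (reduct C) A _ (fun k => w (w' (x k))) e emb).2 r id.
have h2 := (same_atoms_comp (fun k => w' (x k)) e'e).2 r id.
rewrite -[Q _ _]/(@rrel S A r (fun k => e' (w' (x k)))).
apply: iff_trans (iff_sym h2); apply: iff_trans h1.
by have -> : (fun k => w (w' (x k))) = x by apply: funext => k; rewrite wK.
Qed.

End OrderSequence.

(** * From ages to indiscernible pictures *)

Lemma same_atoms_id_embedding (S : signature) (A B : rstructure S)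
    (e : univ A -> univ B) : same_atoms (id : univ A -> univ A) e -> is_embedding e.
Proof. by move=> [h1 h2]; split=> [x y /h1|r c]; last exact: (h2 r c). Qed.

Lemma generic_sub (S : signature) (K : rstructure S -> Prop) (A B : rstructure S)
    (J : finType) (w : J -> univ B) :
  generic_model K A -> K B -> injective w ->
  K (@mk_rstructure S J (fun r c => @rrel S B r (w \o c))).
Proof.
move=> [_ Kgen _] /Kgen[_ [[e [einj eE]]]] winj; apply/Kgen; split.
  exact: finite_finset.
constructor; exists (e \o w); split=> [|r c]; last exact: eE.
exact: inj_comp einj winj.
Qed.

(** The Ramsey property, applied successively to finitely many colourings, each
    one of tuples of its own length; a colouring of tuples only matters through
    the colours of the embeddings of the structure that the tuple spans. *)
Lemma ramsey_tuples (S : signature) (K : rstructure S -> Prop) (A : rstructure S)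
    (B : rstructure S) (Q : Type) (n : Q -> nat) (a b : forall q, 'I_(n q) -> univ B)
    (l : seq Q) :
  generic_model K A -> ramsey_property K -> K B ->
  (forall q, List.In q l -> same_atoms (a q) (b q)) ->
  exists C, K C /\
    forall chi : (forall q, ('I_(n q) -> univ C) -> Prop),
    exists u : univ B -> univ C, is_embedding u /\
      forall q, List.In q l -> (chi q (u \o a q) <-> chi q (u \o b q)).
Proof.
move=> genA ramK KB.
elim: l => [|q l IH] hl.
  by exists B; split=> // chi; exists id; split=> //; split.
have [C' [KC' hC']] := IH (fun q h => hl q (or_intror h)).
have ab := hl q (or_introl erefl).
have fina : finite_set (range (a q)) by apply: finite_image; apply: finite_finset.
(* The structure spanned by the tuple; the entries of the tuple may repeat,
   hence the separate enumeration [w] of its range, with [k] and [t] the two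
   changes of index. *)
have [J [w [winj wE]]] := finite_set_tuple fina.
have /choice[k kE] : forall j, exists k, a q k = w j.
  move=> j; have /wE[k _ e] : exists j', w j' = w j by exists j.
  by exists k.
have /choice[t tE] : forall k, exists j, w j = a q k.
  by move=> i; apply/wE; exists i.
pose D := @mk_rstructure S J (fun r c => @rrel S B r (w \o c)).
have KD : K D := generic_sub genA KB winj.
have idw : @same_atoms S D B J id w by split=> // i j; split=> [->|/winj].
have [C [KC hC]] := ramK D C' KD KC' 2 isT.
exists C; split=> // chi.
pose xi (e : embedding D C) : 'I_2 := if `[< chi q (sval e \o t) >] then ord_max else ord0.
have [[u' u'emb] /= hu'] := hC xi.
have [u [uemb hu]] := hC' (fun q' c => chi q' (u' \o c)).
exists (u' \o u); split.
  split; first exact: inj_comp u'emb.1 uemb.1.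
  by move=> r c; rewrite uemb.2 u'emb.2.
move=> q' [<-|/hu//].
(* The two tuples are the images of one tuple of [D] under two embeddings of
   [D] into the copy of [C']. *)
have emb1 : @is_embedding S D C (u' \o (u \o w)).
  apply: same_atoms_id_embedding; apply: same_atoms_trans idw _.
  apply: same_atoms_trans (same_atoms_embedding _ uemb) _.
  exact: same_atoms_embedding.
have wb : same_atoms w (b q \o k).
  have -> : w = a q \o k by apply: funext => j; rewrite /= kE.
  exact: same_atoms_comp.
have emb2 : @is_embedding S D C (u' \o (u \o (b q \o k))).
  apply: same_atoms_id_embedding; apply: same_atoms_trans idw _.
  apply: same_atoms_trans wb _.
  apply: same_atoms_trans (same_atoms_embedding _ uemb) _.
  exact: same_atoms_embedding.
have := hu' (exist _ _ emb1) (exist _ _ emb2).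
rewrite /xi /=.
have -> : (u' \o (u \o w)) \o t = (u' \o u) \o a q.
  by apply: funext => i /=; rewrite tE.
have -> : (u' \o (u \o (b q \o k))) \o t = (u' \o u) \o b q.
  by apply: funext => i /=; congr (u' (u _)); apply/ab.1; rewrite kE tE.
have r1 : range (u' \o (u \o w)) `<=` range u' by move=> _ [x _ <-]; exists (u (w x)).
have r2 : range (u' \o (u \o (b q \o k))) `<=` range u'.
  by move=> _ [x _ <-]; exists (u (b q (k x))).
by move=> /(_ r1 r2); case: asboolP => h1; case: asboolP => h2.
Qed.

Section Realization.
Variables (S : signature) (K : rstructure S -> Prop) (A : rstructure S).
Hypotheses (genA : generic_model K A) (ramK : ramsey_property K).
Variables (L : language) (T : theory L) (s : lsort L).
Variable psi : forall r : symb S, formula (@const_ctx L 'I_(arity r) s).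

Definition represents (B : rstructure S) (M : structure L) (c : univ B -> M s) :=
  injective c /\ forall r (x : 'I_(arity r) -> univ B),
    rrel x <-> sat (psi r) (c \o x : env M (@const_ctx L 'I_(arity r) s)).

Hypothesis realized : forall B, K B ->
  exists (M : structure L) (c : univ B -> M s), models M T /\ represents c.

Record ind_instance := IndInstance {
  ii_n : nat;
  ii_formula : formula (@const_ctx L 'I_ii_n s);
  ii_left : 'I_ii_n -> univ A;
  ii_right : 'I_ii_n -> univ A;
  ii_same : same_atoms ii_left ii_right }.

(** What finitely many of the axioms below require of a map, and therefore all
    that has to be achieved before compactness applies. *)
Definition locally_good (W : set (univ A)) (l : seq ind_instance) (M : structure L)
    (c : univ A -> M s) : Prop :=
  [/\ forall x y, W x -> W y -> c x = c y -> x = y,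
      forall r (x : 'I_(arity r) -> univ A), (forall k, W (x k)) ->
        (rrel x <-> sat (psi r) (c \o x : env M (@const_ctx L 'I_(arity r) s))) &
      forall q, List.In q l ->
        sat (ii_formula q) (c \o @ii_left q : env M (@const_ctx L 'I_(ii_n q) s)) ->
        sat (ii_formula q) (c \o @ii_right q : env M (@const_ctx L 'I_(ii_n q) s))].

Lemma locally_good_sub (W W' : set (univ A)) (l l' : seq ind_instance)
    (M : structure L) (c : univ A -> M s) :
  W' `<=` W -> (forall q, List.In q l' -> List.In q l) ->
  locally_good W l c -> locally_good W' l' c.
Proof.
move=> sW sl [h1 h2 h3]; split=> [x y /sW Wx /sW Wy|r x Wx|q /sl].
- exact: h1.
- by apply: h2 => k; apply: sW.
- exact: h3.
Qed.

(** The set [W] spans a structure of the class; the Ramsey property provides a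
    larger one in which, for the colourings given by the formulas of [l] pulled
    back along a representing map, some copy of [W] satisfies all the instances
    in [l]. *)
Lemma locally_good_exists (x0 : univ A) (W : set (univ A)) (l : seq ind_instance) :
  finite_set W ->
  (forall q, List.In q l ->
     forall k, W (@ii_left q k) /\ W (@ii_right q k)) ->
  exists (M : structure L) (c : univ A -> M s), models M T /\ locally_good W l c.
Proof.
move=> finW hl.
have finW0 : finite_set (W `|` [set x0]) by rewrite finite_setU; split.
have [J [w [winj wE]]] := finite_set_tuple finW0.
have [j0 _] : exists j, w j = x0 by apply/wE; right.
(* A retraction onto the index type of [W], total thanks to [x0]. *)
have /choice[rho rhoE] : forall x, exists j, W x -> w j = x.
  move=> x; have [Wx|n] := pselect (W x); last by exists j0.
  have /wE[j hj] : (W `|` [set x0]) x by left.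
  by exists j.
pose B := @mk_rstructure S J (fun r c => @rrel S A r (w \o c)).
have KB : K B.
  have [_ Kgen _] := genA; apply/Kgen; split; first exact: finite_finset.
  by constructor; exists w.
have rhow (V : Type) (x : V -> univ A) : (forall v, W (x v)) ->
    @same_atoms S A B V x (rho \o x).
  move=> Wx; have e : w \o (rho \o x) = x by apply: funext => v /=; rewrite rhoE.
  apply: same_atoms_sym; rewrite -{2}e; split=> [v v'|r c].
    by split=> [/(congr1 w)|/winj].
  by [].
have hl' q : List.In q l ->
    @same_atoms S B B _ (rho \o @ii_left q) (rho \o @ii_right q).
  move=> ql; apply: same_atoms_trans (same_atoms_sym (rhow _ _ _)) _.
    by move=> k; have [] := hl q ql k.
  apply: same_atoms_trans (ii_same q) (rhow _ _ _).
  by move=> k; have [] := hl q ql k.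
have [C [KC hC]] := ramsey_tuples genA ramK KB hl'.
have [M [f [MT [finj fE]]]] := realized KC.
have [u [[uinj uE] hu]] := hC (fun q t =>
  sat (ii_formula q) (f \o t : env M (@const_ctx L 'I_(ii_n q) s))).
exists M, (fun x => f (u (rho x))); split=> //; split.
- by move=> x y Wx Wy /finj/uinj e; rewrite -(rhoE x Wx) -(rhoE y Wy) e.
- move=> r x Wx; rewrite ((rhow _ x Wx).2 r id).
  apply: iff_trans (uE r (rho \o x)) _; exact: fE.
- by move=> q /hu [h _].
Qed.

(** The conditions on the variables indexed by [A] whose solutions are the
    representing indiscernible pictures. *)
Inductive picture_axiom : formula (@const_ctx L (univ A) s) -> Prop :=
| pa_rel r (x : 'I_(arity r) -> univ A) :
    rrel x -> picture_axiom (frename x (psi r))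
| pa_nrel r (x : 'I_(arity r) -> univ A) :
    ~ rrel x -> picture_axiom (f_not (frename x (psi r)))
| pa_neq x y : x <> y ->
    picture_axiom (f_not (f_eq (tvar (@const_ctx L (univ A) s) x)
                               (tvar (@const_ctx L (univ A) s) y)))
| pa_ind (q : ind_instance) :
    picture_axiom (f_imp (frename (@ii_left q) (ii_formula q))
                         (frename (@ii_right q) (ii_formula q))).

Lemma picture_axiom_local (p : formula (@const_ctx L (univ A) s)) :
  picture_axiom p ->
  exists (W : set (univ A)) (l : seq ind_instance),
    [/\ finite_set W,
        forall q, List.In q l -> forall k, W (@ii_left q k) /\ W (@ii_right q k) &
        forall (M : structure L) (c : univ A -> M s), locally_good W l c ->
          sat p (c : env M (@const_ctx L (univ A) s))].
Proof.
have finr n (x : 'I_n -> univ A) : finite_set (range x).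
  by apply: finite_image; apply: finite_finset.
case=> [r x hx|r x hx|x y xy|q].
- exists (range x), [::]; split=> // M c [_ h _].
  by rewrite sat_frename -h// => k; exists k.
- exists (range x), [::]; split=> // M c [_ h _].
  by rewrite sat_not sat_frename -h// => k; exists k.
- exists ([set x] `|` [set y]), [::]; split=> //.
  by move=> M c [h _ _] /= /h; move=> /(_ (or_introl erefl) (or_intror erefl)).
- exists (range (@ii_left q) `|` range (@ii_right q)), [:: q]; split.
  + by rewrite finite_setU; split.
  + by move=> q' [<-|//] k; split; [left|right]; exists k.
  + move=> M c [_ _ /(_ q (or_introl erefl)) h].
    by rewrite -[sat _ _]/(sat (frename (@ii_left q) (ii_formula q)) _ ->
      sat (frename (@ii_right q) (ii_formula q)) _) !sat_frename.
Qed.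

Lemma picture_exists (x0 : univ A) :
  exists (M : structure L) (c : univ A -> M s),
    [/\ models M T, indiscernible_picture c & uncollapsed c].
Proof.
have [l hl|M [c0 [MT hc]]] := @compactness L T (univ A) (@const_ctx L (univ A) s)
    [set p | picture_axiom p].
  have [W [lq [finW hW good]]] : exists (W : set (univ A)) (lq : seq ind_instance),
    [/\ finite_set W,
        forall q, List.In q lq -> forall k, W (@ii_left q k) /\ W (@ii_right q k) &
        forall (M : structure L) (c : univ A -> M s), locally_good W lq c ->
          forall p, List.In p l -> sat p (c : env M (@const_ctx L (univ A) s))].
    elim: l hl => [|p l IH] hl.
      by exists set0, [::]; split.
    have [W1 [l1 [f1 h1 g1]]] := picture_axiom_local (hl p (or_introl erefl)).
    have [W2 [l2 [f2 h2 g2]]] := IH (fun q h => hl q (or_intror h)).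
    exists (W1 `|` W2), (l1 ++ l2)%SEQ; split.
    - by rewrite finite_setU; split.
    - move=> q /(@List.in_app_or _ _ _ _)[/h1|/h2] h k; have [] := h k.
        by split; left.
      by split; right.
    - move=> M c good p' [<-|pl].
        apply: g1; apply: locally_good_sub good; first by move=> x; left.
        by move=> q ql; apply: List.in_or_app; left.
      apply: g2 pl; apply: locally_good_sub good; first by move=> x; right.
      by move=> q ql; apply: List.in_or_app; right.
  have [M [c [MT hc]]] := locally_good_exists x0 finW hW.
  by exists M, c; split=> //; apply: good.
pose c : univ A -> M s := c0.
have {}hc p : picture_axiom p -> sat p (c : env M (@const_ctx L (univ A) s)) := hc p.
have cinj : injective c.
  by move=> x y e; apply: contrapT => /pa_neq/hc /=; apply.
have crel r (x : 'I_(arity r) -> univ A) :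
    rrel x <-> sat (psi r) (c \o x : env M (@const_ctx L 'I_(arity r) s)).
  split=> [/pa_rel/hc|h]; first by rewrite sat_frename.
  by apply: contrapT => /pa_nrel/hc; rewrite sat_not sat_frename; apply.
exists M, c; split=> //.
  split=> // n a b /qftp_same_atoms ab.
  have imp a' b' (ab' : same_atoms a' b') (p : formula (@const_ctx L 'I_n s)) :
      sat p (c \o a' : env M (@const_ctx L 'I_n s)) ->
      sat p (c \o b' : env M (@const_ctx L 'I_n s)).
    have := hc _ (pa_ind (IndInstance p ab')).
    rewrite -[sat (f_imp _ _) _]/(sat (frename a' p) c -> sat (frename b' p) c).
    by rewrite !sat_frename.
  by rewrite predeqE => p; split; apply: imp => //; apply: same_atoms_sym.
move=> n a b e; apply/qftp_same_atoms.
have {}e (p : formula (@const_ctx L 'I_n s)) :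
    sat p (c \o a : env M (@const_ctx L 'I_n s)) <->
    sat p (c \o b : env M (@const_ctx L 'I_n s)).
  move: e; rewrite predeqE => /(_ p) [h1 h2].
  by split; [exact: h1|exact: h2].
split=> [v w|r x].
  have := e (f_eq (tvar (@const_ctx L 'I_n s) v) (tvar (@const_ctx L 'I_n s) w)).
  by move=> [h1 h2]; split=> h; apply: cinj; [apply: h1|apply: h2]; rewrite /= h.
have := e (frename x (psi r)).
by rewrite !sat_frename -[(c \o a) \o x]/(c \o (a \o x)) -[(c \o b) \o x]/(c \o (b \o x))
  -!crel.
Qed.

End Realization.

(** * The two implications *)

(** Elimination of imaginaries applied to the equality of tuples. *)
Lemma imaginaries_coding (L : language) (T : theory L) (M : structure L)
    (s : lsort L) (J : finType) :
  eliminates_imaginaries T -> models M T ->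
  exists (s' : lsort L) (h : (J -> M s) -> M s'), coding h.
Proof.
move=> ei MT.
pose G := @const_ctx L 'I_#|J| s.
have [s' [p hp]] := ei _ _ _ (@tuple_eq_equivalence _ T _ G).
have [h [hgr hinj]] := hp M MT.
pose ev : 'I_#|J| -> J := enum_val.
exists s', (fun z : J -> M s => h (fun i => z (ev i))); split.
  move=> z z' /hinj/sat_tuple_eq e; apply: funext => j.
  by have := congr1 (fun f => f (enum_rank j)) e; rewrite /ev /= enum_rankK.
pose H := ctx_cons s' (@const_ctx L J s).
pose r (o : option 'I_#|J|) : term H (ctx_cons s' G o) :=
  match o return term H (ctx_cons s' G o) with
  | Some i => tvar H (Some (ev i))
  | None => tvar H None
  end.
exists (fsubst p r) => a c; rewrite sat_fsubst -hgr.
suff -> : (fun v => eval (env_cons c a) (r v)) = env_cons c ((fun i => a (ev i)) : env M G) by [].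
by apply: functional_extensionality_dep => -[].
Qed.

Section Implications.
Variables (S : signature) (K : rstructure S -> Prop).
Variables (A : rstructure S) (Alt : rstructure (order_signature S)).
Hypotheses (genA : generic_model K A) (genAlt : generic_model (order_class K) Alt).
Hypothesis mobA : mobile A.
Hypothesis AA : models A (Th A).
Variables (L : language) (T : theory L).

(** The ordered structures, and not only those of [K], are realized in an age of
    [T], so that the order as well as the relations of [K] are defined by
    formulas on the picture; this makes it un-collapsed. *)
Lemma picture_of_trianglelefteq :
  unstable (Th A) -> ramsey_property (order_class K) ->
  trianglelefteq (eq_theory (Th A)) T ->
  exists (M : structure L) (s : lsort L) (g : univ Alt -> M s),
    [/\ models M T, indiscernible_picture g & uncollapsed g].
Proof.
move=> unst ramK le.
have [phi1 h1] := order_class_age genA AA mobA unst.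
have [phi2 h2] := le _ _ phi1.
pose s := fs_sort phi2.
pose psi (r : symb (order_signature S)) : formula (@const_ctx L 'I_(arity r) s) :=
  eq_rect _ (fun r : symb (order_signature S) =>
               formula (@const_ctx L 'I_(arity r) s))
    (fs_formula phi2 (enum_rank r)) r (enum_rankK r).
have real B : order_class K B -> exists (M : structure L) (c : univ B -> M s),
    models M T /\ represents psi c.
  move=> /h1/h2[M [X [f [MT [finj _] [e [[einj eE] _]]]]]].
  exists M, (fun x => f (e x)); split=> //; split; first exact: inj_comp finj einj.
  move=> r; rewrite /psi; move: (enum_rankK r); move: (enum_rank r) => i.
  by case: _ / => x; apply: (eE i x).
have [a0] := AA.1 tt.
have [x0] : inhabited (univ Alt).
  have lin1 : strict_linear_order (fun _ _ : unit => False).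
    by split=> // -[] []; apply: Or32.
  have inj1 : injective (fun _ : unit => a0 : univ A) by move=> [] [].
  have K1 := order_pull_class genA (@finite_finset unit _) inj1 lin1.
  by have [e _] := generic_embedding genAlt K1; constructor; apply: (e tt).
have [M [c hc]] := picture_exists genAlt ramK real x0.
by exists M, s, c.
Qed.

Lemma mobile_infinite : infinite_set [set: univ A].
Proof.
have [a0] := AA.1 tt.
move=> fin.
have [|z [nz _]] := mobA (y := fun _ : unit => a0 : univ A) (i := tt) _ fin.
  by case.
exact: nz.
Qed.

Lemma private_elements (B : {fset nat}) (F : set (univ A)) : finite_set F ->
  exists e : B -> univ A, injective e /\ forall b, ~ F (e b).
Proof.
move=> finF; have /infiniteP/card_leP[h] := infinite_setD mobile_infinite finF.
have hinj : injective h by move=> x y; apply: inj; rewrite inE.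
exists (fun b => set_val (h (SigSub (mem_set (I : [set: nat] (val b)))))).
split=> [b b'|b]; first by move=> /val_inj/hinj[/val_inj].
by have [] := set_mem (valP (h (SigSub (mem_set (I : [set: nat] (val b)))))).
Qed.

(** Which linear order is put on the range of [y] is immaterial. *)
Lemma copy_in_order (I : finType) (y : I -> univ A) :
  exists y' : I -> univ Alt, @same_atoms S (reduct Alt) A I y' y.
Proof.
have fin : finite_set (range y) by apply: finite_image; apply: finite_finset.
have [J [w [winj wE]]] := finite_set_tuple fin.
have /choice[t tE] : forall i, exists j, w j = y i by move=> i; apply/wE; exists i.
have lin : strict_linear_order (fun j k : J => (val j < val k)%N).
  split=> [j|j k l|j k]; first by rewrite ltnn.
    exact: ltn_trans.
  case: (ltngtP (val j) (val k)) => [h|h|/val_inj h].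
  - exact: Or31.
  - exact: Or33.
  - exact: Or32.
have KJ := order_pull_class genA (@finite_finset _ _) winj lin.
have [v vemb] := generic_embedding genAlt KJ.
exists (v \o t).
have [h _] := (same_atoms_order _ _).1 (@same_atoms_embedding _
  (order_pull w (fun j k : J => (val j < val k)%N)) Alt I t v vemb).
have -> : y = w \o t by apply: funext => i; rewrite /= tE.
exact: same_atoms_trans (same_atoms_sym h) (reduct_order_pull _ _ winj).
Qed.

(** The non-algebraicity required of the maps in F(T) is not inherited from the
    given structure: it is created by the private elements, the entries at [None]
    of the tuples, on which the relations do not depend. *)
Lemma trianglelefteq_of_picture (M : structure L) (s : lsort L)
    (g : univ Alt -> M s) :
  eliminates_imaginaries T -> models M T ->
  indiscernible_picture g -> uncollapsed g ->
  trianglelefteq (eq_theory (Th A)) T.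
Proof.
move=> ei MT ind unc N ar phi1; have [_ _ homA] := genA.
pose s1 := fs_sort phi1; pose J : finType := option 'I_(rep_size s1).
have [s' [h hh]] := imaginaries_coding s J ei MT.
pose G V := @const_ctx (eq_language (Th A)) V s1.
pose reps n := {v : 'I_n & 'I_(rep_size (G 'I_n v))}.
pose idx n (k : reps n) : 'I_n * J := (tag k, Some (tagged k)).
pose Q (i : 'I_N) (a : 'I_(ar i) * J -> univ Alt) : Prop :=
  exists d : reps (ar i) -> univ A,
    @same_atoms S A (reduct Alt) _ d (a \o @idx (ar i)) /\
    sat (fs_formula phi1 i) (rep_tuple d).
have Qinv i a b : same_atoms a b -> Q i a -> Q i b.
  move=> /same_atoms_order[ab _] [d [da hd]]; exists d; split=> //.
  apply: same_atoms_trans da _.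
  exact: (same_atoms_comp (@idx (ar i)) ab).
have [phi2 hphi2] := @picture_age _ Alt L M s g s' J h hh T N ar Q MT ind unc
  (mobile_order genA genAlt mobA) Qinv.
exists phi2 => C [M1 [B [f1 [M1T _ [e1 [[e1inj e1E] e1bij]]]]]].
have [f2 f2E] : exists f2 : B -> eq_structure (Th A) A s1,
    forall i (c : 'I_(ar i) -> B),
      sat (fs_formula phi1 i) (f2 \o c : env _ (G 'I_(ar i))) <->
      sat (fs_formula phi1 i) (f1 \o c : env _ (G 'I_(ar i))).
  pose X : finType := {i : 'I_N & {ffun 'I_(ar i) -> B}}.
  pose F (x : X) : formula (G B) := frename (tagged x) (fs_formula phi1 (tag x)).
  have [p hp] := definable_boolean F
    (fun v => v = [ffun x => `[< sat (F x) (f1 : env M1 (G B)) >]]).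
  have [|f2] := @eq_theory_exists _ A M1 B (G B) p AA M1T.
    by exists f1; apply/hp.
  move=> /hp/ffunP f2E; exists f2 => i c.
  have := f2E (Tagged (fun i => {ffun 'I_(ar i) -> B}) (finfun c)).
  rewrite !ffunE /F /= => e.
  have -> : c = (finfun c : {ffun _ -> _}) by apply: funext => k; rewrite ffunE.
  split=> hs.
    by have /asboolP := (sat_frename _ _ _).2 hs; rewrite e => /asboolP/sat_frename.
  by have /asboolP := (sat_frename _ _ _).2 hs; rewrite -e => /asboolP/sat_frename.
have [d dE] := rep_tuple_surj f2.
have find : finite_set (range d) by apply: finite_image; apply: finite_finset.
have [e [einj ed]] := private_elements B find.
pose y1 (k : B * J) : univ A :=
  match k.2 with None => e k.1 | Some j => d (existT _ k.1 j) end.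
have [y2 y21] := copy_in_order y1.
have finC : finite_structure C.
  have : finite_set [set: B] by apply: finite_finset.
  have [e1' e1K e1'K] := e1bij.
  move=> /(finite_image e1'); apply: sub_finite_set => x _.
  by exists (e1 x).
apply: (hphi2 C finC (fun k => y2 (e1 k.1, k.2))).
  move=> c; exists None => -[c' [j|]] n /=.
    by move=> /(y21.1 _ _) ec; apply: (ed (e1 c)); exists (existT _ (e1 c') j).
  by move=> /(y21.1 _ _)/einj/e1inj cc; apply: n; rewrite cc.
move=> i c; apply: iff_trans (e1E i c) _.
pose d' (k : reps (ar i)) : univ A := d (existT _ (e1 (c (tag k))) (tagged k)).
have d'E : rep_tuple d' = f2 \o (e1 \o c) :> env _ (G 'I_(ar i)) by rewrite dE.
pose idx' (k : reps (ar i)) : B * J := (e1 (c (tag k)), Some (tagged k)).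
have d'y : @same_atoms S A (reduct Alt) _ d' (y2 \o idx').
  exact: same_atoms_sym (same_atoms_comp idx' y21).
apply: iff_trans (iff_sym (f2E i (e1 \o c))) _; rewrite -d'E.
split=> [hd|[d'' [dy hd]]]; first by exists d'.
apply: sat_rep_tuple hd => //.
exact: same_atoms_trans dy (same_atoms_sym d'y).
Qed.

End Implications.

Theorem theorem3p15 (S : signature) (K : rstructure S -> Prop)
    (A : rstructure S) (Alt : rstructure (order_signature S)) :
  fraisse_class K ->
  generic_model K A ->
  generic_model (order_class K) Alt ->
  algebraically_trivial (Th A) ->
  unique_1type (Th A) ->
  unstable (Th A) ->
  simply_ramsey_expandable K ->
  forall (L : language) (T : theory L), in_TT T ->
    (in_C (Th A) T <->
     exists (M : structure L) (s : lsort L) (g : univ Alt -> M s),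
       [/\ models M T, indiscernible_picture g & uncollapsed g]).
Proof.
move=> _ genA genAlt triv _ unst ramK L T TT.
have AA : models A (Th A).
  apply: models_Th => -[].
  have [m [n [G [H [p [M [MA _]]]]]]] := unst.
  have [|e _] := @Th_exists _ A M unit (fun _ => tt) (f_not f_bot) MA.
    have x := inhabited_witness (MA.1 tt).
    by exists (fun _ => x) => h.
  by constructor; apply: (e tt).
have mobA := trivial_mobile triv.
split=> [[_ le]|[M [s [g [MT ind unc]]]]].
  exact: (picture_of_trianglelefteq genA genAlt mobA AA unst ramK le).
split=> //; have [_ _ ei] := TT.
exact: (trianglelefteq_of_picture genA genAlt mobA AA ei MT ind unc).
Qed.
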